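(* Let $\beta^{(6)}=\{\beta_{ij}\}_{i,j\ge 0,\ i+j\le 6}$ be a collection of real numbers, let $\mathcal M(3)=\mathcal M(3)(\beta^{(6)})$ be its moment matrix, let $\mathcal V\equiv\mathcal V(\mathcal M(3))\subseteq\mathbb R^2$ be the algebraic variety of $\mathcal M(3)(\beta^{(6)})$, and let $v$ be the cardinality of $\mathcal V$ ($v=+\infty$ is a possible value). If $\mathcal M(3)$ is consistent, $\mathcal M(3)\ge 0$, $\mathcal M(2)>0$, $\operatorname{rank}\mathcal M(3)=7$, and $v\ge 8$, then $\beta^{(6)}$ has a $7$-atomic representing measure.
   Context: For a real collection $\beta\equiv\beta^{(2n)}=\{\beta_{ij}\}_{i,j\in\mathbb Z_+,\ i+j\le 2n}$, a representing measure for $\beta$ is a positive Borel measure $\mu$ on $\mathbb R^2$ with $\beta_{ij}=\int x^iy^j\,d\mu$ for all $i,j\in\mathbb Z_+$ with $i+j\le 2n$; it is $k$-atomic if it has the form $\mu=\sum_{l=1}^k\rho_l\,\delta_{(x_l,y_l)}$ with $k$ distinct points $(x_l,y_l)\in\mathbb R^2$ and all $\rho_l>0$. The moment matrix is $\mathcal M(n)\equiv\mathcal M(n)(\beta):=(\beta_{\mathbf i+\mathbf j})_{\mathbf i,\mathbf j\in\mathbb Z_+^2,\ |\mathbf i|,|\mathbf j|\le n}$, with rows and columns labelled by the monomials $1,X,Y,X^2,XY,Y^2,\dots,X^n,X^{n-1}Y,\dots,Y^n$; for $m\le n$, $\mathcal M(m)$ is the moment matrix of the moments of order at most $2m$, i.e.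 the principal submatrix of $\mathcal M(n)$ indexed by monomials of degree at most $m$. Here $\ge 0$ means positive semidefinite and $>0$ means positive definite. For a real polynomial $p(x,y)=\sum a_{ij}x^iy^j$ of degree at most $n$, $p(X,Y):=\sum a_{ij}X^iY^j$ denotes the corresponding linear combination of columns of $\mathcal M(n)$, i.e. $p(X,Y)=\mathcal M(n)\widehat p$ with $\widehat p$ the coefficient vector of $p$. With $\mathcal Z(p)\subseteq\mathbb R^2$ the zero set of $p$, the algebraic variety is $\mathcal V\equiv\mathcal V(\mathcal M(n)):=\bigcap_{\deg p\le n,\ p(X,Y)=0}\mathcal Z(p)$. The Riesz functional is $\Lambda(\sum a_{ij}x^iy^j):=\sum a_{ij}\beta_{ij}$ on polynomials of degree at most $2n$. $\mathcal M(n)$ (or $\beta$) is consistent if $\Lambda(p)=0$ for every real polynomial $p$ with $\deg p\le 2n$ and $p|_{\mathcal V}\equiv 0$. *)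

(* Defs.v *)
From HB Require Import structures.
From mathcomp Require Import all_boot all_order all_algebra.
(* The notations of mpoly are left out: they clash with those of analysis. *)
From mathcomp Require Import -(notations) mpoly.
From mathcomp Require Import all_classical all_reals all_analysis measurable_realfun.

Set Implicit Arguments.
Unset Strict Implicit.
Unset Printing Implicit Defensive.

Import Order.TTheory GRing.Theory Num.Theory.

Local Open Scope classical_set_scope.
Local Open Scope ring_scope.

(* Exponents (i, j) of the monomials X^i Y^j of degree at most n, listed as
   1, X, Y, X^2, XY, Y^2, ..., X^n, X^(n-1) Y, ..., Y^n. *)
Definition monos (n : nat) : seq (nat * nat) :=
  [seq ((d - k)%N, k) | d <- iota 0 n.+1, k <- iota 0 d.+1].

Definition mono (n : nat) (a : 'I_(size (monos n))) : nat * nat :=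
  tnth (in_tuple (monos n)) a.

(* A collection of moments of order at most 2n is encoded by a total function
   beta : nat -> nat -> R, of which only the values beta i j with
   i + j <= 2n are ever relevant. *)
Definition momentmx (R : realType) (n : nat) (beta : nat -> nat -> R) :
    'M[R]_(size (monos n)) :=
  \matrix_(a, b) beta ((mono a).1 + (mono b).1)%N ((mono a).2 + (mono b).2)%N.

Definition psdmx (R : realType) (k : nat) (A : 'M[R]_k) : Prop :=
  A^T = A /\ forall u : 'cV[R]_k, 0 <= (u^T *m A *m u) ord0 ord0.

Definition pdmx (R : realType) (k : nat) (A : 'M[R]_k) : Prop :=
  A^T = A /\ forall u : 'cV[R]_k, u != 0 -> 0 < (u^T *m A *m u) ord0 ord0.

Definition bipoly (R : realType) := mpoly.mpoly 2 R.

(* msize is 1 + degree, and 0 for the zero polynomial. *)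
Definition deg_le (R : realType) (d : nat) (p : bipoly R) : Prop :=
  (mpoly.mmeasure (@mpoly.mdeg 2) p <= d.+1)%N.

Definition peval (R : realType) (p : bipoly R) (z : R * R) : R :=
  mpoly.meval (tnth [tuple z.1; z.2]) p.

Definition coefvec (R : realType) (n : nat) (p : bipoly R) :
    'cV[R]_(size (monos n)) :=
  \col_a mpoly.mcoeff (mpoly.Multinom [tuple (mono a).1; (mono a).2]) p.

(* The linear combination p(X, Y) of the columns of the moment matrix. *)
Definition colcomb (R : realType) (n : nat) (beta : nat -> nat -> R)
    (p : bipoly R) : 'cV[R]_(size (monos n)) :=
  momentmx n beta *m coefvec n p.

Definition variety (R : realType) (n : nat) (beta : nat -> nat -> R) :
    set (R * R) :=
  \bigcap_(p in [set p : bipoly R | deg_le n p /\ colcomb n beta p = 0])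
    [set z | peval p z = 0].

Definition riesz (R : realType) (beta : nat -> nat -> R) (p : bipoly R) : R :=
  \sum_(m <- mpoly.msupp p)
    mpoly.mcoeff m p * beta (m ord0) (m ord_max).

Definition consistent (R : realType) (n : nat) (beta : nat -> nat -> R) : Prop :=
  forall p : bipoly R, deg_le (2 * n) p ->
    (forall z, variety n beta z -> peval p z = 0) -> riesz beta p = 0.

(* R * R carries the product of the Borel sigma-algebras of R, that is, the
   Borel sigma-algebra of the plane. *)
Definition representing (R : realType) (n : nat) (beta : nat -> nat -> R)
    (mu : {measure set (R * R) -> \bar R}) : Prop :=
  forall i j : nat, (i + j <= 2 * n)%N ->
    let f (z : R * R) := (z.1 ^+ i * z.2 ^+ j)%:E in
    mu.-integrable [set: R * R] f /\
    (\int[mu]_(z in [set: R * R]) f z = (beta i j)%:E)%E.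

Definition atomic (R : realType) (k : nat)
    (mu : {measure set (R * R) -> \bar R}) : Prop :=
  exists (z : 'I_k -> R * R) (rho : 'I_k -> R),
    [/\ injective z, forall l, 0 < rho l &
        forall A : set (R * R), measurable A ->
          mu A = (\sum_(l < k) (rho l)%:E * \d_(z l) A)%E].

(* Main.v *)
Require Import Defs.
From HB Require Import structures.
From mathcomp Require Import all_boot all_order all_algebra.
From mathcomp Require Import -(notations) mpoly.
From mathcomp.real_closed Require Import -(notations) complex.
From mathcomp Require Import ring zify.
From mathcomp Require Import all_classical all_reals all_analysis measurable_realfun.

Set Implicit Arguments.
Unset Strict Implicit.
Unset Printing Implicit Defensive.

Import Order.TTheory GRing.Theory Num.Theory.
Import numFieldNormedType.Exports.

Local Open Scope classical_set_scope.
Local Open Scope card_scope.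
Local Open Scope ring_scope.

(** The kernel of M(3) is a space N of polynomials of degree at most 3, of
    dimension 10 - 7 = 3, and V is its zero set.  Because M(2) > 0, no nonzero
    element of N has degree at most 2: N is a net of honest cubics.

    A net of cubics with no nonzero element of lower degree cannot have eight
    base points unless four of them are collinear ([no_eight_base_points]).
    A cubic that vanishes at four points of a line contains the line, so that
    N = l G for a line l and a net G of conics containing no nonzero polynomial
    of degree at most 1 ([net_common_line]).  Hence V is the union of l and of
    the base points of G: a finite variety with eight points does not occur.

    Consistency and M(2) > 0 forbid V to lie on a conic ([not_on_conic]).  So V
    has three non-collinear points w_i off l, and no others: the polynomials of
    degree at most 2 are the sums of an affine function and an element of G, so
    every conic through the w_i passes through the base points of G
    ([off_line_triangle]).

    By consistency the Riesz functional of a multiple l s of the line depends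
    only on the values of l s at the three points w_i ([riesz_mul_line]).
    Subtracting the corresponding masses leaves a functional that kills the
    multiples of l, that is, a functional on polynomials in the coordinate of
    the line.  The masses are positive because M(2) > 0.  The residual functional
    is positive on nonzero squares of polynomials of degree at most 3: such a
    polynomial extends to a cubic in the plane that vanishes at the w_i, to which
    M(3) >= 0 applies, with equality only for elements of N, which vanish on l
    ([residual_gt0]).  Gaussian integration with four nodes represents the residual
    functional up to degree 7 ([gauss_quadrature]).  The three points w_i and the
    four nodes are the seven atoms. *)

(** * Positive functionals in one variable *)

Lemma kernel_row (F : fieldType) (m n : nat) (A : 'M[F]_(m, n)) :
  (n < m)%N -> exists2 u : 'rV[F]_m, u != 0 & u *m A = 0.
Proof.
move=> lt_nm; have ker_neq0 : kermx A != 0.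
  rewrite -mxrank_eq0 mxrank_ker subn_eq0 -ltnNge.
  exact: leq_ltn_trans (rank_leq_col A) lt_nm.
exists (nz_row (kermx A)); first by rewrite nz_row_eq0.
by apply/sub_kermxP; exact: nz_row_sub.
Qed.

(** The monic quadratic with roots a + bi and a - bi; for b = 0 it has the
    double root a, so that non-real and repeated roots are handled together. *)
Definition conj_quad (R : rcfType) (a b : R) : {poly R} :=
  ('X - a%:P) ^+ 2 + (b ^+ 2)%:P.

Lemma size_conj_quad (R : rcfType) (a b : R) : size (conj_quad a b) = 3%N.
Proof.
have size_sq : size (('X - a%:P) ^+ 2) = 3%N by rewrite size_exp_XsubC.
by rewrite /conj_quad size_polyDl size_sq // ltnS (leq_trans (size_polyC_leq1 _)).
Qed.

(** The remainder has degree at most 1, real coefficients and a non-real root. *)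
Lemma conj_quad_dvdp (R : rcfType) (p : {poly R}) (a b : R) : b != 0 ->
  root (map_poly (real_complex R) p) (Complex a b) -> conj_quad a b %| p.
Proof.
move=> b_neq0 /eqP root_p; set q := conj_quad a b.
have q_neq0 : q != 0 by rewrite -size_poly_eq0 size_conj_quad.
have: (map_poly (real_complex R) q).[Complex a b] = 0.
  rewrite /q /conj_quad rmorphD rmorphXn rmorphB /= map_polyX !map_polyC /=.
  rewrite !hornerE expr2; apply/eqP; rewrite eq_complex /=.
  by apply/andP; split; apply/eqP; ring.
move=> q0; move: root_p; rewrite {1}(divp_eq p q) rmorphD rmorphM /= !hornerE q0.
rewrite mulr0 add0r.
have := ltn_modpN0 p q_neq0; rewrite size_conj_quad /dvdp ltnS.
set r := p %% q => size_r.
have -> : r = (r`_0)%:P + (r`_1)%:P * 'X.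
  apply/polyP => -[|[|k]]; rewrite coefD coefC coefMX /= ?coefC /= ?addr0 ?add0r //.
  by apply: nth_default; apply: leq_trans size_r _.
rewrite rmorphD rmorphM /= map_polyX !map_polyC /= !hornerE.
move/eqP; rewrite eq_complex /= => /andP[/eqP re_eq0 /eqP im_eq0].
have r1 : r`_1 = 0.
  have : r`_1 * b = 0 by rewrite -[RHS]im_eq0; ring.
  by move/eqP; rewrite mulf_eq0 (negbTE b_neq0) orbF => /eqP.
have r0 : r`_0 = 0 by rewrite -[RHS]re_eq0 r1; ring.
by rewrite r0 r1 mul0r addr0.
Qed.

(** Over the complex numbers p splits; a non-real root and a repeated real root
    both produce a divisor of the form [conj_quad a b]. *)
Lemma distinct_real_roots (R : rcfType) (n : nat) (p : {poly R}) :
  size p = n.+1 -> (forall a b, ~~ (conj_quad a b %| p)) ->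
  exists t : n.-tuple R, uniq t /\ all (root p) t.
Proof.
move=> size_p no_quad.
set pC := map_poly (real_complex R) p.
have [zs def_pC] := closed_field_poly_normal pC.
have pC_neq0 : pC != 0 by rewrite map_poly_eq0 -size_poly_eq0 size_p.
have size_zs : size zs = n.
  have : size pC = n.+1 by rewrite size_map_poly.
  by rewrite def_pC size_scale ?lead_coef_eq0 // size_prod_XsubC => -[].
have root_zs z : z \in zs -> root pC z.
  by move=> z_zs; rewrite def_pC rootZ ?lead_coef_eq0 // root_prod_XsubC.
have real_zs z : z \in zs -> z = real_complex R (complex.Re z).
  case: z => a b /root_zs root_z; have [-> //|b_neq0] := eqVneq b 0.
  by case/negP: (no_quad a b); apply: conj_quad_dvdp.
have uniq_zs : uniq zs.
  case: (boolP (uniq zs)) => // /uniqPn-/(_ 0)[i [j [lt_ij lt_j eq_ij]]].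
  have := real_zs _ (mem_nth 0 lt_j); set z := nth 0 zs j => real_z.
  case/negP: (no_quad (complex.Re z) 0).
  rewrite -(dvdp_map (real_complex R)) /conj_quad expr0n addr0.
  rewrite rmorphXn rmorphB /= map_polyX map_polyC /= -real_z.
  rewrite -/pC def_pC dvdpZr ?lead_coef_eq0 //.
  have z_take : z \in take j zs.
    by rewrite /z -eq_ij -(nth_take 0 lt_ij) mem_nth // size_take lt_j.
  rewrite -(cat_take_drop j zs) big_cat /= (drop_nth 0) // big_cons -/z.
  by rewrite (big_rem z) //= mulrACA -expr2 dvdp_mulr.
exists (map_tuple (@complex.Re R) (Tuple (introT eqP size_zs))); split.
  rewrite map_inj_in_uniq // => z1 z2 /real_zs -> /real_zs -> /= ->.
  by [].
apply/allP => _ /mapP[z z_zs ->]; have := root_zs z z_zs.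
by rewrite {1}(real_zs z z_zs) /pC fmorph_root.
Qed.

(** The nodes are the roots of the orthogonal polynomial p of degree n, which
    exists because orthogonality to the n monomials of lower degree is n
    conditions on n + 1 coefficients.  If p = s Q with Q = [conj_quad a b], then
    orthogonality to s gives
    0 = L (p s) = L (((X - a) s)^2) + b^2 L (s^2) > 0,
    so the roots are real and distinct.  Division by p reduces the formula to
    degree less than n, where it is Lagrange interpolation. *)
Lemma gauss_quadrature (R : rcfType) (n : nat) (L : {scalar {poly R}}) :
  (forall h : {poly R}, h != 0 -> (size h <= n)%N -> 0 < L (h ^+ 2)) ->
  exists (t : n.-tuple R) (w : 'I_n -> R),
    [/\ uniq t, forall j, 0 < w j &
      forall r : {poly R}, (size r <= n.*2)%N ->
        L r = \sum_(j < n) w j * r.[tnth t j]].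
Proof.
move=> L_gt0.
have [u u_neq0 uH] := @kernel_row R n.+1 n
  (\matrix_(i < n.+1, j < n) L ('X^i * 'X^j)) (ltnSn n).
pose p := rVpoly u.
have p_neq0 : p != 0.
  by apply: contra_neq u_neq0 => p0; rewrite -(rVpolyK u) -/p p0 linear0.
have def_p : p = \sum_i u 0 i *: 'X^i.
  rewrite /p [in LHS](row_sum_delta u) linear_sum.
  by apply: eq_bigr => i _; rewrite linearZ /= rVpoly_delta.
have orth (h : {poly R}) : (size h <= n)%N -> L (p * h) = 0.
  move=> size_h; rewrite -(coefK h) poly_def.
  rewrite mulr_sumr linear_sum big1 // => j _.
  rewrite -scalerAr linearZ.
  suff -> : L (p * 'X^j) = 0 by rewrite /= mulr0.
  have j_lt_n : (j < n)%N := leq_trans (ltn_ord j) size_h.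
  have /rowP/(_ (Ordinal j_lt_n)) := uH; rewrite !mxE => eq0.
  rewrite -[RHS]eq0 def_p mulr_suml linear_sum.
  by apply: eq_bigr => i _; rewrite -scalerAl linearZ /= !mxE.
have size_p_le : (size p <= n.+1)%N by exact: size_poly.
have size_p : size p = n.+1.
  apply/eqP; rewrite eqn_leq size_p_le ltnNge; apply/negP => size_p.
  by have := L_gt0 p p_neq0 size_p; rewrite expr2 orth // ltxx.
have [a b|t [uniq_t root_t]] := distinct_real_roots size_p.
  apply/negP => /dvdpP[s def_ps].
  have s_neq0 : s != 0 by apply: contra_neq p_neq0 => s0; rewrite def_ps s0 mul0r.
  have size_s : (size s).+2 = n.+1.
    rewrite -size_p def_ps size_mul // -?size_poly_eq0 ?size_conj_quad //.
    by rewrite addnS addn2.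
  have size_s_le : (size s <= n)%N by rewrite -ltnS -size_s ltnS leqnSn.
  have := orth s size_s_le.
  have -> : p * s = (('X - a%:P) * s) ^+ 2 + (b ^+ 2) *: s ^+ 2.
    by rewrite def_ps /conj_quad -mul_polyC; ring.
  have size_Xs : (size (('X - a%:P) * s)%R <= n)%N.
    by rewrite size_mul ?polyXsubC_eq0 // size_XsubC /= -ltnS -size_s.
  rewrite linearD linearZ /= => eq0.
  have Xs_gt0 := L_gt0 _ (mulf_neq0 (negbT (polyXsubC_eq0 a)) s_neq0) size_Xs.
  have s_gt0 := L_gt0 _ s_neq0 size_s_le.
  by have := ltr_wpDr (mulr_ge0 (sqr_ge0 b) (ltW s_gt0)) Xs_gt0; rewrite eq0 ltxx.
have tI : injective (tnth t) by apply/tuple_uniqP.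
pose e (j : 'I_n) : {poly R} :=
  \prod_(i < n | i != j) ((tnth t j - tnth t i)^-1 *: ('X - (tnth t i)%:P)).
have eE (i j : 'I_n) : (e j).[tnth t i] = (i == j)%:R.
  rewrite horner_prod; have [->|ne_ij] := eqVneq i j.
    rewrite big1 // => k ne_kj; rewrite !hornerE mulVf // subr_eq0.
    by apply: contra_neq ne_kj => /tI ->.
  by rewrite (bigD1 i) //= !hornerE subrr mulr0 mul0r.
have size_e j : (size (e j) <= n)%N.
  apply: leq_trans (size_poly_prod_leq _ _) _.
  rewrite (eq_bigr (fun=> 2%N)); last first.
    move=> i ne_ij; rewrite size_scale ?size_XsubC // invr_eq0 subr_eq0.
    by apply: contra_neq ne_ij => /tI ->.
  rewrite sum_nat_const cardC1 card_ord.
  by case: (n) j => [[]|m] // _; rewrite /=; lia.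
have L_small (r : {poly R}) : (size r <= n.*2)%N ->
    L r = \sum_(j < n) L (e j) * r.[tnth t j].
  move=> size_r.
  pose T := r %% p; pose S := r %/ p.
  have def_r : r = p * S + T by rewrite mulrC -divp_eq.
  have size_T : (size T <= n)%N by rewrite -ltnS -size_p ltn_modp.
  have size_S : (size S <= n)%N by rewrite size_divp // size_p /= leq_subLR addnn.
  have T_t j : T.[tnth t j] = r.[tnth t j].
    have /allP/(_ (tnth t j) (mem_tnth j t))/rootP p_t := root_t.
    by rewrite def_r hornerD hornerM p_t mul0r add0r.
  have def_T : T = \sum_(j < n) r.[tnth t j] *: e j.
    apply/eqP; rewrite -subr_eq0; apply/eqP/(@roots_geq_poly_eq0 _ _ t) => //.
      apply/allP => x /tnthP[i ->]; rewrite /root hornerD hornerN T_t.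
      rewrite horner_sum (bigD1 i) //= big1 => [|j ne_ji].
        by rewrite hornerZ eE eqxx mulr1 addr0 subrr.
      by rewrite hornerZ eE eq_sym (negbTE ne_ji) mulr0.
    rewrite size_tuple; apply: leq_trans (size_polyD _ _) _.
    rewrite geq_max size_T size_polyN; apply: leq_trans (size_sum _ _ _) _.
    apply/bigmax_leqP => j _; exact: leq_trans (size_scale_leq _ _) (size_e j).
  rewrite {1}def_r linearD orth // add0r def_T linear_sum.
  by apply: eq_bigr => j _; rewrite linearZ /= mulrC.
(* Exactness of the formula on the square of a Lagrange polynomial shows that
   the weights are positive. *)
have w_sq j : L (e j) = L (e j ^+ 2).
  rewrite (L_small (e j ^+ 2)); last first.
    by rewrite expr2; have := size_polyMleq (e j) (e j); have := size_e j; lia.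
  rewrite (bigD1 j) //= big1 => [|i ne_ij].
    by rewrite horner_exp eE eqxx expr1n mulr1 addr0.
  by rewrite horner_exp eE (negbTE ne_ij) expr0n mulr0.
exists t, (fun j => L (e j)); split=> // j; rewrite w_sq; apply: L_gt0 => //.
apply/eqP => e0; have := eE j j; rewrite e0 horner0 eqxx => /eqP.
by rewrite eq_sym oner_eq0.
Qed.

(** * Polynomials of two variables and lines *)

Local Notation bisize p := (mmeasure (@mdeg 2) p).

(** These polynomials are locked because the rules for evaluating sums and
    products would otherwise unfold them during rewriting. *)
HB.lock Definition varX (R : realType) : bipoly R := mpolyX R (mnm1 ord0).
HB.lock Definition varY (R : realType) : bipoly R := mpolyX R (mnm1 ord_max).
Definition dist2 (R : realType) (a b : R * R) : R :=
  (b.1 - a.1) ^+ 2 + (b.2 - a.2) ^+ 2.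

(** The determinant of the vectors b - a and z - a, as a polynomial in z. *)
HB.lock Definition line (R : realType) (a b : R * R) : bipoly R :=
  (b.1 - a.1) *: (varY R - mpolyC 2 a.2) - (b.2 - a.2) *: (varX R - mpolyC 2 a.1).

(** The affine coordinate on the line through a and b with value 0 at a and 1
    at b, extended to the plane by orthogonal projection. *)
HB.lock Definition along (R : realType) (a b : R * R) : bipoly R := (dist2 a b)^-1 *:
  ((b.1 - a.1) *: (varX R - mpolyC 2 a.1) + (b.2 - a.2) *: (varY R - mpolyC 2 a.2)).

Section PlanePolynomials.
Variable R : realType.
Local Notation varX := (@varX R).
Local Notation varY := (@varY R).

Local Notation P := (bipoly R).
Local Notation cst := (@mpolyC 2 R).
Implicit Types (p q f g h : P) (a b z : R * R) (c : R).

Lemma bisizeD d p q :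
  (bisize p <= d)%N -> (bisize q <= d)%N -> (bisize (p + q) <= d)%N.
Proof.
move=> p_d q_d; apply: leq_trans (mmeasureD_le _ _ _) _.
by rewrite geq_max p_d.
Qed.

Lemma bisizeZ d c p : (bisize p <= d)%N -> (bisize (c *: p) <= d)%N.
Proof. by apply: leq_trans; apply: mmeasureZ_le. Qed.

Lemma bisizeB d p q :
  (bisize p <= d)%N -> (bisize q <= d)%N -> (bisize (p - q) <= d)%N.
Proof. by move=> p_d q_d; rewrite bisizeD // mmeasureN. Qed.

Lemma bisize_sum (I : Type) (r : seq I) (Q : pred I) (F : I -> P) d :
  (forall i, Q i -> bisize (F i) <= d)%N -> (bisize (\sum_(i <- r | Q i) F i) <= d)%N.
Proof.
move=> F_d; elim/big_rec: _ => [|i x Qi x_d]; first by rewrite mmeasure0.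
exact: bisizeD (F_d i Qi) x_d.
Qed.

Lemma bisizeM d e p q : (bisize p <= d.+1)%N -> (bisize q <= e)%N ->
  (bisize (p * q) <= d + e)%N.
Proof.
have [->|p0] := eqVneq p 0; first by rewrite mul0r mmeasure0.
have [->|q0] := eqVneq q 0; first by rewrite mulr0 mmeasure0.
move=> p_d q_e; rewrite msizeM // -subn1 leq_subLR addnA add1n.
exact: leq_add p_d q_e.
Qed.

Lemma bisizeC c d : (bisize (cst c) <= d.+1)%N.
Proof. by rewrite mmeasureC; case: (_ == _). Qed.

Lemma bisizeX : bisize varX = 2%N.
Proof. by rewrite varX.unlock mmeasureX /= mdeg1. Qed.

Lemma bisizeY : bisize varY = 2%N.
Proof. by rewrite varY.unlock mmeasureX /= mdeg1. Qed.

Lemma pevalD z p q : peval (p + q) z = peval p z + peval q z.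
Proof. exact: mevalD. Qed.

Lemma pevalM z p q : peval (p * q) z = peval p z * peval q z.
Proof. exact: mevalM. Qed.

Lemma pevalZ z c p : peval (c *: p) z = c * peval p z.
Proof. exact: mevalZ. Qed.

Lemma pevalC z c : peval (cst c) z = c. Proof. exact: mevalC. Qed.

Lemma pevalX z : peval varX z = z.1.
Proof. by rewrite varX.unlock /peval mevalXU (tnth_nth 0). Qed.

Lemma pevalY z : peval varY z = z.2.
Proof. by rewrite varY.unlock /peval mevalXU (tnth_nth 0). Qed.

Lemma pevalB z p q : peval (p - q) z = peval p z - peval q z.
Proof. exact: mevalB. Qed.

Lemma peval0 z : peval (0 : P) z = 0. Proof. exact: meval0. Qed.

Lemma peval1 z : peval (1 : P) z = 1. Proof. exact: meval1. Qed.

Lemma peval_sum z (I : Type) (r : seq I) (Q : pred I) (F : I -> P) :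
  peval (\sum_(i <- r | Q i) F i) z = \sum_(i <- r | Q i) peval (F i) z.
Proof. exact: raddf_sum. Qed.

Lemma pevalXn z p n : peval (p ^+ n) z = peval p z ^+ n.
Proof. exact: rmorphXn. Qed.

(** The recursion behind all inductions on the degree: unlike a decomposition
    into monomials, it is compatible with a change of affine coordinates. *)
Lemma bisize_split d p : (bisize p <= d.+1)%N -> exists c g h,
  [/\ (bisize g <= d)%N, (bisize h <= d)%N & p = cst c + varX * g + varY * h].
Proof.
move=> p_d; rewrite (mpolyE p) big_seq.
apply: (big_ind (fun q => exists c g h, [/\ (bisize g <= d)%N, (bisize h <= d)%N &
  q = cst c + varX * g + varY * h])).
- by exists 0, 0, 0; rewrite mmeasure0 !mulr0 !addr0 mpolyC0.
- move=> _ _ [c [g [h [g_d h_d ->]]]] [c' [g' [h' [g'_d h'_d ->]]]].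
  exists (c + c'), (g + g'), (h + h'); split; rewrite ?bisizeD //.
  by rewrite mpolyCD; ring.
move=> m /msize_mdeg_lt m_lt; set k := mcoeff m p.
have {m_lt} m_d : (mdeg m <= d)%N by rewrite -ltnS (leq_trans m_lt).
have shift (i : 'I_2) : m i != 0 -> exists2 g,
    (bisize g <= d)%N & k *: mpolyX R m = mpolyX R (mnm1 i) * g.
  rewrite -lep1mP => le_im; exists (k *: mpolyX R (mnm_sub m (mnm1 i))).
    rewrite bisizeZ // mmeasureX; move: m_d; rewrite -{1}(submK le_im) mdegD mdeg1.
    by rewrite addn1.
  by rewrite -scalerAr -mpolyXD addmC submK.
have [m0|/shift[g g_d ->]] := eqVneq (m ord0) 0%N; last first.
  by exists 0, g, 0; rewrite varX.unlock mmeasure0 mulr0 addr0 mpolyC0 add0r.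
have [m1|/shift[g g_d ->]] := eqVneq (m ord_max) 0%N; last first.
  by exists 0, 0, g; rewrite varY.unlock mmeasure0 mulr0 addr0 mpolyC0 add0r.
exists k, 0, 0; rewrite mmeasure0 !mulr0 !addr0; split=> //.
have -> : m = mnm0.
  apply/mnmP=> i; rewrite mnm0E; case: i => [[|[|]]] // lt_i.
    by rewrite -[RHS]m0; congr (fun_of_multinom m _); apply: val_inj.
  by rewrite -[RHS]m1; congr (fun_of_multinom m _); apply: val_inj.
by rewrite mpolyX0 -mul_mpolyC mulr1.
Qed.

Lemma peval_horner z q (r : {poly R}) : peval (horner_alg q r) z = r.[peval q z].
Proof.
elim/poly_ind: r => [|r c IHr]; first by rewrite rmorph0 horner0 peval0.
rewrite rmorphD rmorphM /= horner_algX horner_algC pevalD pevalM IHr !hornerE.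
by rewrite pevalZ peval1 mulr1.
Qed.

Lemma horner_algZ q c (r : {poly R}) : horner_alg q (c *: r) = c *: horner_alg q r.
Proof. by rewrite linearZ /= mulr_algl. Qed.

Lemma bisize_horner q (r : {poly R}) d : (bisize q <= 2)%N -> (size r <= d)%N ->
  (bisize (horner_alg q r) <= d)%N.
Proof.
move=> q_2; have bisize_exp i : (bisize (q ^+ i) <= i.+1)%N.
  elim: i => [|i IHi]; first by rewrite expr0 -mpolyC1 bisizeC.
  by rewrite exprS (leq_trans (bisizeM q_2 IHi)).
move=> r_d; rewrite -(coefK r) poly_def linear_sum /=; apply: bisize_sum => i _.
rewrite horner_algZ rmorphXn /= horner_algX bisizeZ // (leq_trans (bisize_exp i)) //.
exact: leq_trans (ltn_ord i) r_d.
Qed.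

Definition line_pt a b t : R * R := (a.1 + t * (b.1 - a.1), a.2 + t * (b.2 - a.2)).

Lemma peval_line a b z : peval (line a b) z =
  (b.1 - a.1) * (z.2 - a.2) - (b.2 - a.2) * (z.1 - a.1).
Proof. by rewrite line.unlock !(pevalB, pevalD, pevalZ, pevalX, pevalY, pevalC). Qed.

Lemma peval_along a b z : peval (along a b) z =
  (dist2 a b)^-1 * ((b.1 - a.1) * (z.1 - a.1) + (b.2 - a.2) * (z.2 - a.2)).
Proof. by rewrite along.unlock !(pevalB, pevalD, pevalZ, pevalX, pevalY, pevalC). Qed.

Lemma bisize_line a b : (bisize (line a b) <= 2)%N.
Proof.
rewrite line.unlock; apply: bisizeB; apply: bisizeZ; apply: bisizeB;
by rewrite ?bisizeC ?bisizeX ?bisizeY.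
Qed.

Lemma bisize_along a b : (bisize (along a b) <= 2)%N.
Proof.
rewrite along.unlock; apply: bisizeZ; apply: bisizeD; apply: bisizeZ; apply: bisizeB;
by rewrite ?bisizeC ?bisizeX ?bisizeY.
Qed.

Lemma dist2_neq0 a b : a != b -> dist2 a b != 0.
Proof.
apply: contra_neq => /eqP; rewrite paddr_eq0 ?sqr_ge0 // !sqrf_eq0 !subr_eq0.
by case: a b => [a1 a2] [b1 b2] /= /andP[/eqP-> /eqP->].
Qed.

Lemma varX_frame a b : a != b -> varX = cst a.1 + (b.1 - a.1) *: along a b
  - ((b.2 - a.2) / dist2 a b) *: line a b.
Proof.
move/dist2_neq0/mulVf/(congr1 (cst)); rewrite mpolyC1 mpolyCM => D_inv.
rewrite line.unlock along.unlock -!mul_mpolyC mpolyCM; move: D_inv.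
rewrite {2}/dist2; set D := cst (dist2 a b)^-1 => D_inv.
rewrite -[LHS](subrK (cst a.1)) -[X in X + _ = _]mul1r -D_inv.
ring.
Qed.

Lemma varY_frame a b : a != b -> varY = cst a.2 + (b.2 - a.2) *: along a b
  + ((b.1 - a.1) / dist2 a b) *: line a b.
Proof.
move/dist2_neq0/mulVf/(congr1 (cst)); rewrite mpolyC1 mpolyCM => D_inv.
rewrite line.unlock along.unlock -!mul_mpolyC mpolyCM; move: D_inv.
rewrite {2}/dist2; set D := cst (dist2 a b)^-1 => D_inv.
rewrite -[LHS](subrK (cst a.2)) -[X in X + _ = _]mul1r -D_inv.
ring.
Qed.

(** [line a b] and [along a b] are affine coordinates of the plane; g and r come
    from expanding p in these coordinates and collecting the terms that contain
    the first one. *)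
Lemma line_division a b d p : a != b -> (bisize p <= d.+1)%N ->
  exists g (r : {poly R}), [/\ (bisize g <= d)%N, (size r <= d.+1)%N &
    p = line a b * g + horner_alg (along a b) r].
Proof.
move=> ne_ab; elim: d p => [|d IHd] p.
  move/msize1_polyC->; exists 0, (mcoeff mnm0 p)%:P.
  by rewrite mmeasure0 size_polyC_leq1 mulr0 add0r horner_algC -mul_mpolyC mulr1.
case/bisize_split=> c [_ [_ [/IHd[g [r [g_d r_d ->]]] /IHd[h [s [h_d s_d ->]]] ->]]].
pose e : R := (dist2 a b)^-1.
exists (varX * g + varY * h + horner_alg (along a b)
   ((((b.1 - a.1) * e) *: s) - (((b.2 - a.2) * e) *: r))),
   (c%:P + (a.1%:P + (b.1 - a.1) *: 'X) * r + (a.2%:P + (b.2 - a.2) *: 'X) * s).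
split.
- apply: bisizeD; last first.
    apply: bisize_horner (bisize_along a b) _.
    rewrite (leq_trans (size_polyD _ _)) // geq_max size_polyN.
    by rewrite !(leq_trans (size_scale_leq _ _)).
  by apply: bisizeD; apply: (leq_trans (bisizeM (d := 1) (e := d) _ _));
     rewrite ?bisizeX ?bisizeY.
- have size_aff (u v : R) (w : {poly R}) : (size w <= d.+1)%N ->
      (size ((u%:P + v *: 'X) * w)%R <= d.+2)%N.
    move=> w_d; rewrite (leq_trans (size_polyMleq _ _)) //.
    have : (size (u%:P + v *: 'X)%R <= 2)%N.
      rewrite (leq_trans (size_polyD _ _)) // geq_max.
      rewrite (leq_trans (size_polyC_leq1 _)) //.
      by rewrite (leq_trans (size_scale_leq _ _)) // size_polyX.
    by move: (size _) (size _) w_d => m n; lia.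
  have size_D (u v : {poly R}) :
      (size u <= d.+2 -> size v <= d.+2 -> size (u + v)%R <= d.+2)%N.
    by move=> u_d v_d; rewrite (leq_trans (size_polyD _ _)) // geq_max u_d.
  by rewrite !size_D ?size_aff // (leq_trans (size_polyC_leq1 _)).
have alongE (u v : R) (w : {poly R}) :
    horner_alg (along a b) ((u%:P + v *: 'X) * w) =
    (cst u + v *: along a b) * horner_alg (along a b) w.
  rewrite rmorphM rmorphD /= horner_algZ horner_algX horner_algC.
  by rewrite -[cst u]mulr1 mul_mpolyC.
rewrite !rmorphD /= !alongE rmorphN /= !horner_algZ horner_algC.
set Ar := horner_alg _ r; set As := horner_alg _ s.
have Xe : (varX - (cst a.1 + (b.1 - a.1) *: along a b
    - ((b.2 - a.2) * e) *: line a b)) * Ar = 0.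
  by rewrite -varX_frame // subrr mul0r.
have Ye : (varY - (cst a.2 + (b.2 - a.2) *: along a b
    + ((b.1 - a.1) * e) *: line a b)) * As = 0.
  by rewrite -varY_frame // subrr mul0r.
apply/eqP; rewrite -subr_eq0; apply/eqP.
have := congr2 +%R Xe Ye; rewrite addr0.
clearbody Ar As; generalize (line a b) (along a b) => l m XYe.
rewrite -[RHS]XYe -!mul_mpolyC.
ring.
Qed.

(** A nonzero remainder of the division by the line would have at most d roots,
    but the points of s give it more, since [along a b] is injective on the
    line. *)
Lemma line_factor a b d p (s : seq (R * R)) : a != b -> (bisize p <= d.+1)%N ->
  uniq s -> (d < size s)%N -> {in s, forall z, peval (line a b) z = 0} ->
  {in s, forall z, peval p z = 0} ->
  exists2 g, (bisize g <= d)%N & p = line a b * g.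
Proof.
move=> ne_ab p_d uniq_s d_lt line_s p_s.
have [g [r [g_d r_d def_p]]] := line_division ne_ab p_d.
exists g => //; suff r0 : r = 0 by rewrite def_p r0 rmorph0 addr0.
apply: (@roots_geq_poly_eq0 _ _ [seq peval (along a b) z | z <- s]).
- apply/allP => _ /mapP[z s_z ->]; rewrite /root -peval_horner.
  by have := p_s z s_z; rewrite def_p pevalD pevalM line_s // mul0r add0r => ->.
- rewrite map_inj_in_uniq // => z w /line_s z_l /line_s w_l eq_m.
  have coord y : peval (line a b) y = 0 ->
      y = line_pt a b (peval (along a b) y).
    move=> y_l; have := congr1 (fun q => peval q y) (varX_frame ne_ab) => /=.
    have := congr1 (fun q => peval q y) (varY_frame ne_ab) => /=.
    rewrite !(pevalB, pevalD, pevalZ, pevalC, pevalX, pevalY) y_l !mulr0 subr0 addr0.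
    case: y {y_l} => y1 y2 /= eq2 eq1; rewrite /line_pt.
    by congr pair; rewrite [RHS]addrC mulrC addrC -?eq1 -?eq2.
  by rewrite (coord z z_l) (coord w w_l) eq_m.
- by rewrite size_map (leq_trans r_d).
Qed.

Lemma peval_line_pt a b t : peval (line a b) (line_pt a b t) = 0.
Proof. by rewrite peval_line /line_pt /=; ring. Qed.

Lemma peval_line_a a b : peval (line a b) a = 0.
Proof. by rewrite peval_line; ring. Qed.

Lemma peval_line_b a b : peval (line a b) b = 0.
Proof. by rewrite peval_line; ring. Qed.

Lemma peval_along_pt a b t : a != b -> peval (along a b) (line_pt a b t) = t.
Proof.
move=> ne_ab; rewrite peval_along /line_pt /=; have := dist2_neq0 ne_ab.
by rewrite /dist2 => D; field.
Qed.

End PlanePolynomials.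

Section LinesAndPoints.
Variable R : realType.
Local Notation P := (bipoly R).
Local Notation cst := (@mpolyC 2 R).
Implicit Types (p q l : P) (a b c z : R * R).

Lemma exists_nonroot (r : {poly R}) : r != 0 -> exists t, r.[t] != 0.
Proof.
move=> r_neq0; case: (boolP (all (root r) [seq i%:R | i <- iota 0 (size r)])).
  move=> all_root; case/negP: r_neq0; apply/eqP/(roots_geq_poly_eq0 all_root).
    by rewrite map_inj_uniq ?iota_uniq //; exact: mulrIn (oner_neq0 _).
  by rewrite size_map size_iota.
by case/allPn => t _ t_r; exists t.
Qed.

Lemma line_restriction a b q : a != b -> exists r : {poly R},
  forall z, peval (line a b) z = 0 -> peval q z = r.[peval (along a b) z].
Proof.
move=> ne_ab; have [g [r [_ _ def_q]]] := line_division ne_ab (leqnSn (bisize q)).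
exists r => z z_l.
by rewrite [in LHS]def_q pevalD pevalM z_l mul0r add0r peval_horner.
Qed.

(** The restriction of q to the line is a nonzero polynomial in one variable;
    multiplying it by a polynomial that vanishes on s avoids s as well. *)
Lemma line_fresh a b q (s : seq (R * R)) : a != b ->
  (exists2 z, peval (line a b) z = 0 & peval q z != 0) ->
  exists z, [/\ peval (line a b) z = 0, z \notin s & peval q z != 0].
Proof.
move=> ne_ab [z0 z0_l q_z0]; have [r q_on] := line_restriction q ne_ab.
have r_neq0 : r != 0.
  by apply: contraNneq q_z0 => r0; rewrite q_on // r0 horner0.
have prod_neq0 := monic_neq0 (monic_prod_XsubC
  [seq peval (along a b) z | z <- s] predT id).
have [t] := exists_nonroot (mulf_neq0 r_neq0 prod_neq0).
rewrite hornerM mulf_eq0 negb_or => /andP[r_t].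
rewrite -[_ == 0]/(root _ _) root_prod_XsubC => t_s.
exists (line_pt a b t); rewrite peval_line_pt q_on ?peval_line_pt // peval_along_pt //.
split=> //; apply: contra t_s => t_s.
by apply/mapP; exists (line_pt a b t); rewrite ?peval_along_pt.
Qed.

(** It suffices to restrict p and q to the line through a point where p does not
    vanish and a point where q does not vanish. *)
Lemma nonvanishing_mul p q : (exists z, peval p z != 0) ->
  (exists z, peval q z != 0) -> exists z, peval (p * q) z != 0.
Proof.
move=> [a p_a] [b q_b]; have [eq_ab|ne_ab] := eqVneq a b.
  by exists a; rewrite pevalM mulf_neq0 // eq_ab.
have [r p_on] := line_restriction p ne_ab; have [s q_on] := line_restriction q ne_ab.
have r_neq0 : r != 0.
  by apply: contraNneq p_a => r0; rewrite p_on ?peval_line_a // r0 horner0.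
have s_neq0 : s != 0.
  by apply: contraNneq q_b => s0; rewrite q_on ?peval_line_b // s0 horner0.
have [t] := exists_nonroot (mulf_neq0 r_neq0 s_neq0).
rewrite hornerM -(peval_along_pt t ne_ab) -p_on ?peval_line_pt //.
by rewrite -q_on ?peval_line_pt // -pevalM; exists (line_pt a b t).
Qed.

Lemma line_nonvanishing a b : a != b -> exists z, peval (line a b) z != 0.
Proof.
move/dist2_neq0 => D; exists (a.1 - (b.2 - a.2), a.2 + (b.1 - a.1)).
by rewrite peval_line /=; move: D; rewrite /dist2; apply: contra_neq => <-; ring.
Qed.

Lemma line_rot a b c : peval (line a b) c = peval (line b c) a.
Proof. by rewrite !peval_line; ring. Qed.

Lemma line_swap a b c : peval (line b a) c = - peval (line a b) c.
Proof. by rewrite !peval_line; ring. Qed.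

Lemma noncollinear_neq a b c : peval (line a b) c != 0 -> a != b.
Proof. by apply: contra_neq => ->; rewrite peval_line; ring. Qed.

Lemma off_line l q z : peval (l * q) z = 0 -> peval l z != 0 -> peval q z = 0.
Proof. by rewrite pevalM => /eqP; rewrite mulf_eq0 => /orP[-> //|/eqP]. Qed.

Lemma const_eq0 q z : (bisize q <= 1)%N -> peval q z = 0 -> q = 0.
Proof. by move/msize1_polyC ->; rewrite pevalC => ->; rewrite mpolyC0. Qed.

Lemma affine_eq0 q a b c : (bisize q <= 2)%N -> peval (line a b) c != 0 ->
  peval q a = 0 -> peval q b = 0 -> peval q c = 0 -> q = 0.
Proof.
move=> q_2 c_l q_a q_b q_c; have ne_ab := noncollinear_neq c_l.
have [||||k k_1 def_q] := @line_factor _ a b 1 q [:: a; b] ne_ab q_2.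
- by rewrite /= inE ne_ab.
- by [].
- by move=> z; rewrite !inE => /orP[]/eqP->; rewrite ?peval_line_a ?peval_line_b.
- by move=> z; rewrite !inE => /orP[]/eqP->.
rewrite def_q (const_eq0 k_1 (z := c)) ?mulr0 //.
by apply: off_line c_l; rewrite -def_q.
Qed.

Definition comb n (f : 'I_n -> P) (u : 'rV[R]_n) : P := \sum_i u ord0 i *: f i.

Lemma comb_peval0 n (f : 'I_n -> P) u z : (forall i, peval (f i) z = 0) ->
  peval (comb f u) z = 0.
Proof. by move=> f_z; rewrite peval_sum big1 // => i _; rewrite pevalZ f_z mulr0. Qed.

Lemma bisize_comb n (f : 'I_n -> P) u (d : nat) : (forall i, bisize (f i) <= d)%N ->
  (bisize (comb f u) <= d)%N.
Proof. by move=> f_d; apply: bisize_sum => i _; apply: bisizeZ. Qed.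

(** Vanishing at a point is one linear condition on the coefficients u. *)
Lemma exists_comb n (f : 'I_n -> P) (s : seq (R * R)) : (size s < n)%N ->
  exists2 u, u != 0 & {in s, forall z, peval (comb f u) z = 0}.
Proof.
move=> lt_s; have [u u_neq0 uA] := @kernel_row _ _ _
  (\matrix_(i < n, j < size s) peval (f i) (nth (0, 0) s j)) lt_s.
exists u => // z z_s; have j_lt : (index z s < size s)%N by rewrite index_mem.
have /rowP/(_ (Ordinal j_lt)) := uA; rewrite !mxE peval_sum => uA0.
by rewrite -[RHS]uA0; apply: eq_bigr => i _; rewrite pevalZ mxE /= nth_index.
Qed.

(** Cramer's rule: the determinant [peval (line a b) c] of the two equations for
    z - a is nonzero. *)
Lemma line_meet a b c z : peval (line a b) c != 0 ->
  peval (line a b) z = 0 -> peval (line a c) z = 0 -> z = a.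
Proof.
rewrite !peval_line; case: a b c z => [a1 a2] [b1 b2] [c1 c2] [z1 z2] /= D l1 l2.
congr pair; apply/eqP; rewrite -subr_eq0; apply/eqP/(mulfI D); rewrite mulr0.
  rewrite -[RHS](_ : (c1 - a1) * 0 - (b1 - a1) * 0 = 0); last by ring.
  by rewrite -{1}l1 -{1}l2; ring.
rewrite -[RHS](_ : (c2 - a2) * 0 - (b2 - a2) * 0 = 0); last by ring.
by rewrite -{1}l1 -{1}l2; ring.
Qed.

Lemma ord3P (k : 'I_3) : [\/ k = inord 0, k = inord 1 | k = inord 2].
Proof.
by case: k => [[|[|[|//]]] k_lt]; [apply: Or31|apply: Or32|apply: Or33];
  apply: val_inj; rewrite /= inordK.
Qed.

(** The affine function attached to a vertex is the opposite side of the
    triangle, suitably scaled. *)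
Lemma lagrange3 (w : 'I_3 -> R * R) :
  peval (line (w (inord 0)) (w (inord 1))) (w (inord 2)) != 0 ->
  exists e : 'I_3 -> P, (forall i, (bisize (e i) <= 2)%N) /\
    forall i j, peval (e i) (w j) = (i == j)%:R.
Proof.
set a := w _; set b := w _; set c := w _ => D.
pose e (i : 'I_3) : P := (peval (line a b) c)^-1 *:
  (if i == inord 0 then line b c else if i == inord 1 then line c a else line a b).
exists e; split=> [i|i j].
  by rewrite bisizeZ //; case: ifP => _; [|case: ifP => _]; apply: bisize_line.
have neE k k' : (k < 3)%N -> (k' < 3)%N -> (inord k == inord k' :> 'I_3) = (k == k').
  by move=> lt_k lt_k'; rewrite -val_eqE /= !inordK.
have line_bc : peval (line b c) a = peval (line a b) c by rewrite -line_rot.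
have line_ca : peval (line c a) b = peval (line a b) c by rewrite line_rot.
rewrite pevalZ /e; case: (ord3P i) => ->; rewrite !neE //=;
  case: (ord3P j) => ->; rewrite !neE // -/a -/b -/c;
  by rewrite ?line_bc ?line_ca ?peval_line_a ?peval_line_b ?mulr0 // mulVf.
Qed.

End LinesAndPoints.

(** * Nets of plane cubics with eight base points *)

Section Nets.
Variable R : realType.
Local Notation P := (bipoly R).
Local Notation cst := (@mpolyC 2 R).
Implicit Types (p q l m k : P) (a b c d e f g h z : R * R).

Lemma line_factor3 a b c q : (bisize q <= 3)%N -> uniq [:: a; b; c] ->
  peval (line a b) c = 0 -> peval q a = 0 -> peval q b = 0 -> peval q c = 0 ->
  exists2 g, (bisize g <= 2)%N & q = line a b * g.
Proof.
move=> q_3 uniq_abc c_l q_a q_b q_c; apply: (@line_factor _ a b 2 q [:: a; b; c]) => //.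
- by move: uniq_abc => /=; rewrite inE negb_or => /andP[/andP[]].
- by move=> z; rewrite !inE => /or3P[]/eqP->; rewrite ?peval_line_a ?peval_line_b.
- by move=> z; rewrite !inE => /or3P[]/eqP->.
Qed.

Lemma line_factor4 a b c d q : (bisize q <= 4)%N -> uniq [:: a; b; c; d] ->
  peval (line a b) c = 0 -> peval (line a b) d = 0 ->
  peval q a = 0 -> peval q b = 0 -> peval q c = 0 -> peval q d = 0 ->
  exists2 g, (bisize g <= 3)%N & q = line a b * g.
Proof.
move=> q_4 uniq_s c_l d_l q_a q_b q_c q_d.
apply: (@line_factor _ a b 3 q [:: a; b; c; d]) => //.
- by move: uniq_s => /=; rewrite inE negb_or => /andP[/andP[]].
- by move=> z; rewrite !inE => /or4P[]/eqP->; rewrite ?peval_line_a ?peval_line_b.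
- by move=> z; rewrite !inE => /or4P[]/eqP->.
Qed.

(** Some combination of q and q' vanishes at a third point z of the line de,
    hence contains this line; its other component would be a line through the
    non-collinear points f, g and h. *)
Lemma conic_unique q q' d e f g h : uniq [:: d; e; f; g; h] ->
  (bisize q <= 3)%N -> (bisize q' <= 3)%N ->
  {in [:: d; e; f; g; h], forall z, peval q z = 0 /\ peval q' z = 0} ->
  {in [:: f; g; h], forall z, peval (line d e) z != 0} ->
  peval (line f g) h != 0 ->
  exists u : R * R, u != 0 /\ u.1 *: q + u.2 *: q' = 0.
Proof.
move=> uniq_s q_3 q'_3 q_s off_de h_fg.
have ne_de : d != e by apply: (noncollinear_neq (off_de f _)); rewrite inE eqxx.
have [|z [z_l z_s _]] := @line_fresh _ d e 1 [:: d; e] ne_de.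
  by exists d; rewrite ?peval_line_a // peval1 oner_neq0.
pose Q (i : 'I_2) := if i == ord0 then q else q'.
have [u u_neq0 u_z] := exists_comb Q (isT : size [:: z] < 2)%N.
exists (u ord0 ord0, u ord0 ord_max); split.
  apply: contra_neq u_neq0 => -[u0 u1]; apply/rowP => -[[|[|//]] i_lt]; rewrite mxE.
    by rewrite -[RHS]u0; congr (u _ _); apply: val_inj.
  by rewrite -[RHS]u1; congr (u _ _); apply: val_inj.
have -> : u ord0 ord0 *: q + u ord0 ord_max *: q' = comb Q u.
  by rewrite /comb big_ord_recl big_ord1 /Q /=; congr (_ + u _ _ *: _); apply: val_inj.
have cQ_3 : (bisize (comb Q u) <= 3)%N.
  by apply: bisize_comb => i; rewrite /Q; case: ifP.
have cQ y : y \in [:: d; e; f; g; h] -> peval (comb Q u) y = 0.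
  by case/q_s=> q_y q'_y; apply: comb_peval0 => i; rewrite /Q; case: ifP.
have uniq_dez : uniq [:: d; e; z].
  by move: z_s; rewrite /= !inE !negb_or ne_de ![z == _]eq_sym => /andP[-> ->].
have [|||k k_2 def_cQ] := line_factor3 cQ_3 uniq_dez z_l.
- by apply: cQ; rewrite inE eqxx.
- by apply: cQ; rewrite !inE eqxx orbT.
- by apply: u_z; rewrite inE.
suff k0 : k = 0 by rewrite def_cQ k0 mulr0.
have k_off y : y \in [:: f; g; h] -> peval k y = 0.
  move=> y_s; apply: off_line (off_de y y_s); rewrite -def_cQ cQ //.
  by rewrite in_cons [X in _ || X]in_cons y_s !orbT.
by apply: (affine_eq0 k_2 h_fg); apply: k_off; rewrite !inE eqxx ?orbT.
Qed.

(** The span of F is a net of cubics in the sense of projective geometry; the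
    hypothesis [F_indep] says that the leading forms are independent as well. *)
Section Net.
Variable F : 'I_3 -> P.
Hypothesis F_4 : forall i, (bisize (F i) <= 4)%N.
Hypothesis F_indep : forall u, (bisize (comb F u) <= 3)%N -> u = 0.

Definition base_point : pred (R * R) := fun z => [forall i, peval (F i) z == 0].

Lemma base_point_comb u z : base_point z -> peval (comb F u) z = 0.
Proof. by move=> /forallP F_z; apply: comb_peval0 => i; apply/eqP. Qed.

Lemma comb_neq0 u : u != 0 -> comb F u != 0.
Proof. by apply: contra_neq => F0; apply: F_indep; rewrite F0 mmeasure0. Qed.

Definition base_points (s : seq (R * R)) := uniq s && all base_point s.

(** Selecting points of a configuration by position turns all conditions on
    subconfigurations and permutations into computations on lists of indices. *)
Lemma base_points_pick s (I : seq nat) :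
  base_points s -> uniq I -> all (fun i => i < size s)%N I ->
  base_points [seq nth (0, 0) s i | i <- I].
Proof.
move=> /andP[uniq_s /allP zero_s] uniq_I /allP I_s; apply/andP; split.
  rewrite map_inj_in_uniq // => i j /I_s i_s /I_s j_s /eqP.
  by rewrite nth_uniq // => /eqP.
by apply/allP => _ /mapP[i /I_s i_s ->]; apply: zero_s; apply: mem_nth.
Qed.

Lemma base_points_neq a b : base_points [:: a; b] -> a != b.
Proof. by rewrite /base_points /= inE andbT => /andP[]. Qed.

(** The situation that is to be refuted for a net with eight base points. *)
Hypothesis no4 : forall a b c d, base_points [:: a; b; c; d] ->
  peval (line a b) c = 0 -> peval (line a b) d != 0.

(** A cubic that vanishes at four points of a line contains the line; the other
    component is a conic through the remaining zeros. *)
Lemma residual_conic a b c d u : uniq [:: a; b; c; d] -> u != 0 ->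
  peval (line a b) c = 0 -> peval (line a b) d = 0 ->
  {in [:: a; b; c; d], forall z, peval (comb F u) z = 0} ->
  exists q, [/\ comb F u = line a b * q, q != 0, (bisize q <= 3)%N &
    forall z, peval (comb F u) z = 0 -> peval (line a b) z != 0 -> peval q z = 0].
Proof.
move=> uniq_s u_neq0 c_ab d_ab Fu.
have [||||q q_3 def_Fu] := line_factor4 (bisize_comb u F_4) uniq_s c_ab d_ab;
  try by apply: Fu; rewrite !inE eqxx ?orbT.
exists q; split=> // [|z Fu_z].
  by apply: contra_neq (comb_neq0 u_neq0) => q0; rewrite def_Fu q0 mulr0.
by apply: off_line; rewrite -def_Fu.
Qed.

(** Vanishing at a fourth point of the line and at z are two conditions on the
    three coefficients of a cubic of the net. *)
Lemma conic_off_triple a b c d e f g h z : base_points [:: a; b; c; d; e; f; g; h] ->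
  peval (line a b) c = 0 -> peval (line a b) z != 0 ->
  exists q, [/\ q != 0, (bisize q <= 3)%N &
    {in [:: d; e; f; g; h; z], forall x, peval q x = 0}].
Proof.
move=> s8 c_ab z_ab; have pick I := base_points_pick (I := I) s8.
have /andP[_ /allP zero_s] := s8.
have /= ne_ab := base_points_neq (pick [:: 0; 1]%N isT isT).
have [|y [y_ab y_s _]] := @line_fresh _ a b 1 [:: a; b; c] ne_ab.
  by exists a; rewrite ?peval_line_a // peval1 oner_neq0.
have [u u_neq0 u_s] := exists_comb F (isT : size [:: y; z] < 3)%N.
have Fu x : x \in [:: a; b; c; d; e; f; g; h] -> peval (comb F u) x = 0.
  by move=> /zero_s; apply: base_point_comb.
have [|x|q [_ q_neq0 q_3 q0]] := residual_conic _ u_neq0 c_ab y_ab.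
- rewrite -[[:: a; b; c; y]]/(rcons [:: a; b; c] y) rcons_uniq y_s.
  by have /andP[] := pick [:: 0; 1; 2]%N isT isT.
- rewrite !inE => /or4P[]/eqP->; last by apply: u_s; rewrite inE eqxx.
  + by apply: Fu; rewrite !inE eqxx.
  + by apply: Fu; rewrite !inE eqxx orbT.
  + by apply: Fu; rewrite !inE eqxx !orbT.
exists q; split=> // x; rewrite !inE => /or4P[/eqP->|/eqP->|/eqP->|/or3P[]/eqP->].
- apply: q0; first by apply: Fu; rewrite !inE eqxx ?orbT.
  exact: no4 (pick [:: 0; 1; 2; 3]%N isT isT) c_ab.
- apply: q0; first by apply: Fu; rewrite !inE eqxx ?orbT.
  exact: no4 (pick [:: 0; 1; 2; 4]%N isT isT) c_ab.
- apply: q0; first by apply: Fu; rewrite !inE eqxx ?orbT.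
  exact: no4 (pick [:: 0; 1; 2; 5]%N isT isT) c_ab.
- apply: q0; first by apply: Fu; rewrite !inE eqxx ?orbT.
  exact: no4 (pick [:: 0; 1; 2; 6]%N isT isT) c_ab.
- apply: q0; first by apply: Fu; rewrite !inE eqxx ?orbT.
  exact: no4 (pick [:: 0; 1; 2; 7]%N isT isT) c_ab.
- by apply: q0 => //; apply: u_s; rewrite !inE eqxx orbT.
Qed.

(** Two disjoint collinear triples abc and def leave g and h.  A cubic of the
    net that contains the line abc and vanishes at a point z is the union of the
    lines abc, def and gh; choosing z off these lines gives a contradiction. *)
Lemma no_two_triples a b c d e f g h : base_points [:: a; b; c; d; e; f; g; h] ->
  peval (line a b) c = 0 -> peval (line d e) f != 0.
Proof.
move=> s8 c_ab; apply/eqP => f_de; have pick I := base_points_pick (I := I) s8.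
have /= ne_ab := base_points_neq (pick [:: 0; 1]%N isT isT).
have /= ne_de := base_points_neq (pick [:: 3; 4]%N isT isT).
have /= ne_gh := base_points_neq (pick [:: 6; 7]%N isT isT).
have /= g_de := no4 (pick [:: 3; 4; 5; 6]%N isT isT) f_de.
have /= h_de := no4 (pick [:: 3; 4; 5; 7]%N isT isT) f_de.
(* A conic through z and the other five base points contains the line de, so
   its other component is a line through g, h and z. *)
have [z] := nonvanishing_mul (nonvanishing_mul (line_nonvanishing ne_ab)
  (line_nonvanishing ne_de)) (line_nonvanishing ne_gh).
rewrite !pevalM !mulf_eq0 !negb_or => /andP[/andP[z_ab z_de] z_gh].
have [q [q_neq0 q_3 q0]] := conic_off_triple s8 c_ab z_ab.
have /andP[/= uniq_def _] := pick [:: 3; 4; 5]%N isT isT.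
have [|||m m_2 def_q] := line_factor3 q_3 uniq_def f_de;
  try by apply: q0; rewrite !inE eqxx ?orbT.
have m0 x : peval q x = 0 -> peval (line d e) x != 0 -> peval m x = 0.
  by move=> q_x; apply: off_line; rewrite -def_q.
case/negP: q_neq0; rewrite def_q (affine_eq0 m_2 z_gh) ?mulr0 //.
- by apply: m0 g_de; apply: q0; rewrite !inE eqxx ?orbT.
- by apply: m0 h_de; apply: q0; rewrite !inE eqxx ?orbT.
- by apply: m0 z_de; apply: q0; rewrite !inE eqxx ?orbT.
Qed.

(** If a, b and c were collinear, then by [no_two_triples] f, g and h would lie
    neither on the line de nor on a common line.  A conic through d, e, f, g, h
    and a further point z of the line de contains this line, and its other
    component would be a line through f, g and h. *)
Lemma no_triple a b c d e f g h : base_points [:: a; b; c; d; e; f; g; h] ->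
  peval (line a b) c != 0.
Proof.
move=> s8; have pick I := base_points_pick (I := I) s8.
apply/eqP => c_ab.
have /= f_de := no_two_triples s8 c_ab.
have /= g_de := no_two_triples (pick [:: 0; 1; 2; 3; 4; 6; 5; 7]%N isT isT) c_ab.
have /= h_de := no_two_triples (pick [:: 0; 1; 2; 3; 4; 7; 5; 6]%N isT isT) c_ab.
have /= h_fg := no_two_triples (pick [:: 0; 1; 2; 5; 6; 7; 3; 4]%N isT isT) c_ab.
have /= d_ab := no4 (pick [:: 0; 1; 2; 3]%N isT isT) c_ab.
have /= ne_de := base_points_neq (pick [:: 3; 4]%N isT isT).
have [|z [z_de z_s z_ab]] := @line_fresh _ d e (line a b) [:: d; e] ne_de.
  by exists d; rewrite ?peval_line_a.
have [q [q_neq0 q_3 q0]] := conic_off_triple s8 c_ab z_ab.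
(* The conic meets the line de in the three points d, e and z. *)
have uniq_dez : uniq [:: d; e; z].
  by rewrite -[[:: d; e; z]]/(rcons [:: d; e] z) rcons_uniq z_s /= inE ne_de.
have [|||m m_2 def_q] := line_factor3 q_3 uniq_dez z_de;
  try by apply: q0; rewrite !inE eqxx ?orbT.
have m0 x : x \in [:: d; e; f; g; h; z] -> peval (line d e) x != 0 -> peval m x = 0.
  by move=> /q0 q_x; apply: off_line; rewrite -def_q.
case/negP: q_neq0; rewrite def_q (affine_eq0 m_2 h_fg) ?mulr0 //.
- by apply: m0 f_de; rewrite !inE eqxx ?orbT.
- by apply: m0 g_de; rewrite !inE eqxx ?orbT.
- by apply: m0 h_de; rewrite !inE eqxx ?orbT.
Qed.

(** Vanishing at two further points of the line ab is two conditions, so some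
    nonzero cubic of the net contains this line. *)
Lemma side_conic a b c d e f g h : base_points [:: a; b; c; d; e; f; g; h] ->
  exists u q, [/\ comb F u = line a b * q, q != 0, (bisize q <= 3)%N &
    {in [:: d; e; f; g; h], forall z, peval q z = 0}].
Proof.
move=> s8; have pick I := base_points_pick (I := I) s8.
have /andP[_ /allP zero_s] := s8.
have /= ne_ab := base_points_neq (pick [:: 0; 1]%N isT isT).
have [|y [y_ab y_s _]] := @line_fresh _ a b 1 [:: a; b] ne_ab.
  by exists a; rewrite ?peval_line_a // peval1 oner_neq0.
have [|z [z_ab z_s _]] := @line_fresh _ a b 1 [:: a; b; y] ne_ab.
  by exists a; rewrite ?peval_line_a // peval1 oner_neq0.
have [u u_neq0 u_s] := exists_comb F (isT : size [:: y; z] < 3)%N.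
have Fu x : x \in [:: a; b; c; d; e; f; g; h] -> peval (comb F u) x = 0.
  by move=> /zero_s; apply: base_point_comb.
have [|x|q [def_Fu q_neq0 q_3 q0]] := residual_conic _ u_neq0 y_ab z_ab.
- rewrite -[[:: a; b; y; z]]/(rcons (rcons [:: a; b] y) z) rcons_uniq z_s.
  by rewrite rcons_uniq y_s /= inE ne_ab.
- rewrite !inE => /or4P[]/eqP->; try by apply: u_s; rewrite !inE eqxx ?orbT.
  + by apply: Fu; rewrite !inE eqxx.
  + by apply: Fu; rewrite !inE eqxx orbT.
exists u, q; split=> // x; rewrite !inE => /or4P[/eqP->|/eqP->|/eqP->|/orP[]/eqP->].
- apply: q0; first by apply: Fu; rewrite !inE eqxx ?orbT.
  exact: no_triple (pick [:: 0; 1; 3; 2; 4; 5; 6; 7]%N isT isT).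
- apply: q0; first by apply: Fu; rewrite !inE eqxx ?orbT.
  exact: no_triple (pick [:: 0; 1; 4; 2; 3; 5; 6; 7]%N isT isT).
- apply: q0; first by apply: Fu; rewrite !inE eqxx ?orbT.
  exact: no_triple (pick [:: 0; 1; 5; 2; 3; 4; 6; 7]%N isT isT).
- apply: q0; first by apply: Fu; rewrite !inE eqxx ?orbT.
  exact: no_triple (pick [:: 0; 1; 6; 2; 3; 4; 5; 7]%N isT isT).
- apply: q0; first by apply: Fu; rewrite !inE eqxx ?orbT.
  exact: no_triple (pick [:: 0; 1; 7; 2; 3; 4; 5; 6]%N isT isT).
Qed.

Lemma combD u v : comb F (u + v) = comb F u + comb F v.
Proof.
by rewrite -big_split; apply: eq_bigr => i _; rewrite mxE scalerDl.
Qed.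

Lemma combZ t u : comb F (t *: u) = t *: comb F u.
Proof. by rewrite scaler_sumr; apply: eq_bigr => i _; rewrite mxE scalerA. Qed.

(** Twice the signed areas of zab, zbc and zca add up to that of abc. *)
Lemma line_triangle a b c :
  line a b + line b c + line c a = cst (peval (line a b) c).
Proof.
rewrite peval_line line.unlock -!mul_mpolyC !(mpolyCM, mpolyCB); ring.
Qed.

(** The conics obtained from the three sides of the triangle abc all pass through
    d, e, f, g and h, so they are proportional to one conic q.  A combination of
    the three cubics is then the product of q with a combination of the sides of
    the triangle, and by [line_triangle] the latter can be made a nonzero
    constant: the net contains q, which has degree less than 3. *)
Lemma no_eight_base_points a b c d e f g h : ~ base_points [:: a; b; c; d; e; f; g; h].
Proof.
move=> s8; have pick I := base_points_pick (I := I) s8.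
have [u [q [def_q q_neq0 q_3 q0]]] := side_conic s8.
have [v [q' [def_q' q'_neq0 q'_3 q'0]]] :=
  side_conic (pick [:: 1; 2; 0; 3; 4; 5; 6; 7]%N isT isT).
have [w [q'' [def_q'' q''_neq0 q''_3 q''0]]] :=
  side_conic (pick [:: 2; 0; 1; 3; 4; 5; 6; 7]%N isT isT).
rewrite /= in def_q' def_q'' q'0 q''0.
have /andP[/= uniq_5 _] := pick [:: 3; 4; 5; 6; 7]%N isT isT.
have off_de : {in [:: f; g; h], forall z, peval (line d e) z != 0}.
  move=> z; rewrite !inE => /or3P[]/eqP->.
  - exact: no_triple (pick [:: 3; 4; 5; 0; 1; 2; 6; 7]%N isT isT).
  - exact: no_triple (pick [:: 3; 4; 6; 0; 1; 2; 5; 7]%N isT isT).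
  - exact: no_triple (pick [:: 3; 4; 7; 0; 1; 2; 5; 6]%N isT isT).
have h_fg := no_triple (pick [:: 5; 6; 7; 0; 1; 2; 3; 4]%N isT isT).
have prop k : k != 0 -> (bisize k <= 3)%N ->
    {in [:: d; e; f; g; h], forall z, peval k z = 0} -> exists t, q = t *: k.
  move=> k_neq0 k_3 k0.
  have [|[s t] [/= st_neq0 st0]] := conic_unique uniq_5 q_3 k_3 _ off_de h_fg.
    by move=> z z_s; rewrite q0 // k0.
  have s_neq0 : s != 0.
    apply: contra_neq st_neq0 => s0; rewrite s0 in st0 *; congr pair.
    move/eqP: st0; rewrite scale0r add0r -mul_mpolyC mulf_eq0 (negbTE k_neq0) orbF.
    by rewrite mpolyC_eq0 => /eqP.
  exists (- (s^-1 * t)); apply: (scalerI s_neq0).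
  rewrite scalerA mulrN mulrA divff // mul1r scaleNr.
  by apply/eqP; rewrite -addr_eq0 st0.
have [t' def_t'] := prop q' q'_neq0 q'_3 q'0.
have [t'' def_t''] := prop q'' q''_neq0 q''_3 q''0.
have c_ab := no_triple s8.
have Fq : comb F (u + t' *: v + t'' *: w) = peval (line a b) c *: q.
  rewrite -mul_mpolyC -line_triangle !combD !combZ def_q def_q' def_q''.
  by rewrite !scalerAr -def_t' -def_t'' !mulrDl.
have q_eq0 : comb F (u + t' *: v + t'' *: w) = 0.
  rewrite (F_indep (u := u + t' *: v + t'' *: w)) ?Fq ?bisizeZ //.
  by rewrite /comb big1 // => i _; rewrite mxE scale0r.
move/eqP: q_eq0; rewrite Fq -mul_mpolyC mulf_eq0 mpolyC_eq0.
by rewrite (negbTE c_ab) (negbTE q_neq0).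
Qed.

End Net.

Lemma net_common_line (F : 'I_3 -> P) (s : seq (R * R)) :
  (forall i, (bisize (F i) <= 4)%N) ->
  (forall u, (bisize (comb F u) <= 3)%N -> u = 0) ->
  base_points F s -> size s = 8%N ->
  exists a b, a != b /\ forall i, exists2 g, (bisize g <= 3)%N & F i = line a b * g.
Proof.
move=> F_4 F_indep zero_s size_s.
have [//|no_line] := pselect (exists a b, a != b /\ forall i, exists2 g,
  (bisize g <= 3)%N & F i = line a b * g).
case: s size_s zero_s => [|a [|b [|c [|d [|e [|f [|g [|h []]]]]]]]] // _ s8.
case: (@no_eight_base_points F F_4 F_indep _ a b c d e f g h s8) => a' b' c' d' s4 c_ab.
apply/eqP => d_ab; apply: no_line; exists a', b'.
have /andP[uniq_4 /and5P[/forallP a0 /forallP b0 /forallP c0 /forallP d0 _]] := s4.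
split=> [|i].
  by move: uniq_4; rewrite cons_uniq !inE !negb_or => /andP[/andP[]].
by apply: line_factor4 uniq_4 c_ab d_ab _ _ _ _ => //; apply/eqP.
Qed.

End Nets.

(** * The Riesz functional and the moment matrix *)

(** Test positivity at u + t A u for small negative t: the linear term in t is
    2 t |A u|^2, so it has to vanish. *)
Lemma psd_kernel (R : realFieldType) k (A : 'M[R]_k) (u : 'cV[R]_k) : A^T = A ->
  (forall v : 'cV[R]_k, 0 <= (v^T *m A *m v) ord0 ord0) ->
  (u^T *m A *m u) ord0 ord0 = 0 -> A *m u = 0.
Proof.
move=> A_sym A_ge0 u0.
pose w := A *m u.
have uAw : (u^T *m A *m w) ord0 ord0 = (w^T *m w) ord0 ord0.
  by rewrite /w trmx_mul A_sym.
have wAu : (w^T *m A *m u) ord0 ord0 = (w^T *m w) ord0 ord0 by rewrite -mulmxA.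
have w_ge0 : 0 <= (w^T *m w) ord0 ord0.
  by rewrite mxE sumr_ge0 // => i _; rewrite mxE -expr2 sqr_ge0.
set s := (w^T *m w) ord0 ord0 in uAw wAu w_ge0.
suff /eqP : s = 0.
  rewrite /s mxE psumr_eq0 => [/allP w0|i _]; last by rewrite mxE -expr2 sqr_ge0.
  apply/colP => i; have /(_ i (mem_index_enum _)) := w0.
  by rewrite mxE -expr2 sqrf_eq0 => /eqP ->; rewrite mxE.
have key t : 0 <= t * (2 * s) + t ^+ 2 * (w^T *m A *m w) ord0 ord0.
  have := A_ge0 (u + t *: w).
  have -> : (u + t *: w)^T = u^T + t *: w^T by rewrite linearD linearZ.
  rewrite !(mulmxDl, mulmxDr) -!scalemxAl -!scalemxAr.
  have addE (B C : 'M[R]_1) : (B + C) ord0 ord0 = B ord0 ord0 + C ord0 ord0.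
    by rewrite mxE.
  have scaleE d (B : 'M[R]_1) : (d *: B) ord0 ord0 = d * B ord0 ord0.
    by rewrite mxE.
  rewrite !(addE, scaleE) u0 uAw wAu; congr (0 <= _); ring.
have c_ge0 := A_ge0 w; set c := (_ *m w) ord0 ord0 in key c_ge0.
have c1_gt0 : 0 < c + 1 by rewrite ltr_wpDl.
have := key (- (s / (c + 1))).
have -> : - (s / (c + 1)) * (2 * s) + (- (s / (c + 1))) ^+ 2 * c =
    - ((s / (c + 1)) ^+ 2 * (c + 2)).
  by field; apply: lt0r_neq0.
rewrite oppr_ge0 pmulr_lle0 ?ltr_wpDl // => sq_le0; apply/eqP.
have /eqP : (s / (c + 1)) ^+ 2 = 0 by apply/le_anti; rewrite sq_le0 sqr_ge0.
by rewrite sqrf_eq0 mulf_eq0 invr_eq0 (gt_eqF c1_gt0) orbF.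
Qed.

(** Summing over a common list of monomials is what makes linearity visible, as
    the supports of p, q and c p + q differ. *)
Lemma riesz_wide (R : realType) (beta : nat -> nat -> R) (p : bipoly R) s :
  uniq s -> {subset msupp p <= s} ->
  riesz beta p = \sum_(m <- s) mcoeff m p * beta (m ord0) (m ord_max).
Proof.
move=> uniq_s sub_s; rewrite [RHS](bigID (mem (msupp p))) /=.
rewrite [X in _ = _ + X]big1 => [|m]; last first.
  by rewrite -mcoeff_eq0 => /eqP->; rewrite mul0r.
rewrite addr0 -[RHS]big_filter; apply: perm_big; apply: uniq_perm.
- exact: msupp_uniq.
- exact: filter_uniq.
by move=> m; rewrite mem_filter /=; case: (boolP (m \in msupp p)) => //= /sub_s ->.
Qed.

Lemma riesz_is_linear (R : realType) (beta : nat -> nat -> R) :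
  linear (riesz beta : bipoly R -> R^o).
Proof.
move=> c p q; pose s := undup (msupp p ++ msupp q ++ msupp (c *: p + q)).
have sub r : r \in [:: p; q; c *: p + q] -> {subset msupp r <= s}.
  by rewrite !inE => /or3P[]/eqP-> m m_r; rewrite mem_undup !mem_cat m_r ?orbT.
rewrite !(@riesz_wide _ _ _ s) ?undup_uniq //;
  try by apply: sub; rewrite !inE eqxx ?orbT.
rewrite scaler_sumr -big_split; apply: eq_bigr => m _ /=.
by rewrite mcoeffD mcoeffZ mulrDl -mulrA.
Qed.

HB.instance Definition _ (R : realType) (beta : nat -> nat -> R) :=
  GRing.isLinear.Build R (bipoly R) R^o _ (riesz beta) (riesz_is_linear beta).

Section RieszMoments.
Variable R : realType.
Local Notation P := (bipoly R).
Implicit Types (p q : P) (beta : nat -> nat -> R).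

Lemma rieszD beta p q : riesz beta (p + q) = riesz beta p + riesz beta q.
Proof. exact: (linearD (riesz beta : {linear P -> R^o})). Qed.

Lemma rieszB beta p q : riesz beta (p - q) = riesz beta p - riesz beta q.
Proof. exact: (linearB (riesz beta : {linear P -> R^o})). Qed.

Lemma rieszZ beta c p : riesz beta (c *: p) = c * riesz beta p.
Proof. exact: (linearZ_LR (riesz beta : {linear P -> R^o})). Qed.

Lemma riesz_sum beta (I : Type) (r : seq I) (Q : pred I) (F : I -> P) :
  riesz beta (\sum_(i <- r | Q i) F i) = \sum_(i <- r | Q i) riesz beta (F i).
Proof. exact: (linear_sum (riesz beta : {linear P -> R^o})). Qed.

Lemma rieszX beta m : riesz beta (mpolyX R m) = beta (m ord0) (m ord_max).
Proof. by rewrite /riesz msuppX big_seq1 mcoeffX eqxx mul1r. Qed.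

Lemma mem_monos n i j : ((i, j) \in monos n) = (i + j <= n)%N.
Proof.
apply/allpairsPdep/idP => [[d [k [d_n k_d [-> ->]]]]|le_n].
  by move: d_n k_d; rewrite !mem_iota; lia.
by exists (i + j)%N, j; rewrite !mem_iota addnK; split=> //; lia.
Qed.

Lemma monos_uniq n : uniq (monos n).
Proof.
apply: allpairs_uniq_dep => [|d _|]; try exact: iota_uniq.
move=> [d k] [d' k'] /allpairsPdep[x [y [_ y_x [-> ->]]]].
move=> /allpairsPdep[x' [y' [_ y'_x [-> ->]]]] /=.
rewrite !mem_iota in y_x y'_x => -[eq1 eq2]; rewrite -eq2 in eq1 y'_x *.
by have -> : x = x' by lia.
Qed.

Definition monom n (a : 'I_(size (monos n))) : multinom 2 :=
  Multinom [tuple (mono a).1; (mono a).2].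

Lemma monom0 n (a : 'I_(size (monos n))) : monom a ord0 = (mono a).1.
Proof. by rewrite multinomE (tnth_nth 0%N). Qed.

Lemma monom1 n (a : 'I_(size (monos n))) : monom a ord_max = (mono a).2.
Proof. by rewrite multinomE (tnth_nth 0%N). Qed.

Lemma mdeg2 (m : multinom 2) : mdeg m = (m ord0 + m ord_max)%N.
Proof.
rewrite mdegE big_ord_recl big_ord1; congr (_ + fun_of_multinom m _)%N.
exact: val_inj.
Qed.

Lemma multinom2P (m m' : multinom 2) :
  m ord0 = m' ord0 -> m ord_max = m' ord_max -> m = m'.
Proof.
move=> eq0 eq1; apply/mnmP => -[[|[|//]] i_lt].
  by have -> : Ordinal i_lt = ord0 by apply: val_inj.
by have -> : Ordinal i_lt = ord_max by apply: val_inj.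
Qed.

Lemma bisize_drop_top d p : (bisize p <= d.+1)%N ->
  (forall k : 'I_d.+1, mcoeff (Multinom [tuple (d - k)%N; k : nat]) p = 0) ->
  (bisize p <= d)%N.
Proof.
move=> p_d p0; rewrite msizeE; apply/bigmax_leqP_seq => m m_p _.
have := leq_trans (msize_mdeg_lt m_p) p_d; rewrite ltnS leq_eqVlt => /orP[/eqP m_d|//].
have m1_lt : (m ord_max < d.+1)%N by rewrite ltnS -m_d mdeg2 leq_addl.
have /eqP := p0 (Ordinal m1_lt); rewrite mcoeff_eq0 => /negP[].
suff -> : Multinom [tuple (d - Ordinal m1_lt)%N; Ordinal m1_lt : nat] = m by [].
apply: multinom2P; rewrite multinomE (tnth_nth 0%N) //=.
by rewrite -m_d mdeg2 addnK.
Qed.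

Lemma mdeg_monom n (a : 'I_(size (monos n))) : (mdeg (monom a) <= n)%N.
Proof.
by rewrite mdeg2 monom0 monom1 -mem_monos -surjective_pairing mem_tnth.
Qed.

Lemma monom_inj n : injective (@monom n).
Proof.
have /tuple_uniqP mono_inj : uniq (in_tuple (monos n)) := monos_uniq n.
move=> a b eq_ab; apply: mono_inj.
rewrite -[LHS]/(mono a) -[RHS]/(mono b).
rewrite (surjective_pairing (mono a)) (surjective_pairing (mono b)).
by rewrite -!monom0 -!monom1 eq_ab.
Qed.

Lemma monom_onto n (m : multinom 2) : (mdeg m <= n)%N -> exists a, @monom n a = m.
Proof.
rewrite mdeg2 -mem_monos => /(tnthP (in_tuple _))[a def_a]; exists a.
by apply: multinom2P; rewrite ?monom0 ?monom1 /mono -def_a.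
Qed.

(** The inverse of [coefvec] on polynomials of degree at most n. *)
Definition vecpoly n (u : 'cV[R]_(size (monos n))) : P :=
  \sum_a u a ord0 *: mpolyX R (monom a).

Lemma bisize_vecpoly n (u : 'cV[R]_(size (monos n))) : (bisize (vecpoly u) <= n.+1)%N.
Proof.
by apply: bisize_sum => a _; rewrite bisizeZ // mmeasureX ltnS mdeg_monom.
Qed.

Lemma mcoeff_vecpoly n (u : 'cV[R]_(size (monos n))) a :
  mcoeff (monom a) (vecpoly u) = u a ord0.
Proof.
rewrite raddf_sum (bigD1 a) //= big1 => [|b ne_ba].
  by rewrite mcoeffZ mcoeffX eqxx mulr1 addr0.
by rewrite mcoeffZ mcoeffX (inj_eq (@monom_inj n)) (negbTE ne_ba) mulr0.
Qed.

Lemma vecpolyK n : cancel (@vecpoly n) (coefvec n).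
Proof. by move=> u; apply/colP => a; rewrite !mxE mcoeff_vecpoly. Qed.

Lemma coefvecK n p : (bisize p <= n.+1)%N -> vecpoly (coefvec n p) = p.
Proof.
move=> p_n; apply/mpolyP => m; case: (leqP (mdeg m) n) => [/monom_onto[a <-]|m_gt].
  by rewrite mcoeff_vecpoly mxE.
rewrite !memN_msupp_eq0 //; apply/negP => /msize_mdeg_lt m_lt.
  by have := leq_trans m_lt p_n; rewrite ltnS leqNgt m_gt.
by have := leq_trans m_lt (bisize_vecpoly _); rewrite ltnS leqNgt m_gt.
Qed.

Lemma riesz_vecpoly n beta (u v : 'cV[R]_(size (monos n))) :
  riesz beta (vecpoly u * vecpoly v) = (u^T *m momentmx n beta *m v) ord0 ord0.
Proof.
rewrite /vecpoly mulr_suml riesz_sum -mulmxA mxE; apply: eq_bigr => a _.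
rewrite !mxE [in LHS]mulr_sumr riesz_sum [in RHS]mulr_sumr; apply: eq_bigr => b _.
rewrite -scalerAl -scalerAr !rieszZ -mpolyXD rieszX !mnmDE !monom0 !monom1.
by rewrite mxE; congr (_ * _); rewrite mulrC.
Qed.

Lemma riesz_moment n beta p q : (bisize p <= n.+1)%N -> (bisize q <= n.+1)%N ->
  riesz beta (p * q) = ((coefvec n p)^T *m momentmx n beta *m coefvec n q) ord0 ord0.
Proof. by move=> p_n q_n; rewrite -riesz_vecpoly !coefvecK. Qed.

Lemma riesz_sqr_ge0 n beta p : psdmx (momentmx n beta) -> (bisize p <= n.+1)%N ->
  0 <= riesz beta (p ^+ 2).
Proof. by move=> [_ M_ge0] p_n; rewrite expr2 (riesz_moment beta p_n p_n). Qed.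

Lemma riesz_sqr_gt0 n beta p : pdmx (momentmx n beta) -> (bisize p <= n.+1)%N ->
  p != 0 -> 0 < riesz beta (p ^+ 2).
Proof.
move=> [_ M_gt0] p_n p_neq0; rewrite expr2 (riesz_moment beta p_n p_n) M_gt0 //.
apply: contra_neq p_neq0 => p0; rewrite -(coefvecK p_n) p0 /vecpoly big1 // => a _.
by rewrite mxE scale0r.
Qed.

Lemma colcomb_comb n beta r (F : 'I_r -> P) u :
  (forall i, colcomb n beta (F i) = 0) -> colcomb n beta (comb F u) = 0.
Proof.
move=> F_ker; rewrite /colcomb.
have -> : coefvec n (comb F u) = \sum_i u ord0 i *: coefvec n (F i).
  apply/colP => x; rewrite summxE mxE raddf_sum; apply: eq_bigr => i _.
  by rewrite /= mcoeffZ !mxE.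
rewrite mulmx_sumr big1 // => i _; rewrite -scalemxAr -[_ *m _]/(colcomb n beta _).
by rewrite F_ker scaler0.
Qed.

(** The kernel of a matrix is a row space, hence the transposes. *)
Lemma kernel_basis n beta r : (\rank (momentmx n beta) + r = size (monos n))%N ->
  exists F : 'I_r -> P, [/\ forall i, (bisize (F i) <= n.+1)%N,
    forall i, colcomb n beta (F i) = 0, forall u, comb F u = 0 -> u = 0 &
    forall p, (bisize p <= n.+1)%N -> colcomb n beta p = 0 -> exists u, p = comb F u].
Proof.
move=> rank_r; set M := momentmx n beta.
have [B [B_ker B_free]] : exists B : 'M[R]_(r, size (monos n)),
    (B :=: kermx M^T)%MS /\ row_free B.
  have : \rank (kermx M^T) = r.
    by rewrite mxrank_ker mxrank_tr -[X in (X - _)%N]rank_r addKn.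
  clear rank_r => rank_r; case: r / rank_r; exists (row_base (kermx M^T)).
  by rewrite row_base_free; split=> //; exact: eq_row_base.
pose F i := vecpoly (row i B)^T.
have combE u : comb F u = vecpoly (u *m B)^T.
  rewrite /comb /vecpoly (eq_bigr _ (fun i _ => scaler_sumr _ _ _ _)) exchange_big /=.
  apply: eq_bigr => x _; rewrite !mxE scaler_suml; apply: eq_bigr => i _.
  by rewrite scalerA !mxE.
exists F; split=> [i|i|u comb0|p p_n ker_p].
- exact: bisize_vecpoly.
- rewrite /colcomb vecpolyK; apply: (can_inj (@trmxK _ _ _)).
  rewrite trmx_mul trmxK trmx0; apply/sub_kermxP.
  by rewrite -B_ker row_sub.
- apply: (row_free_inj B_free); rewrite mul0mx; apply: (can_inj (@trmxK _ _ _)).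
  by rewrite -[LHS]vecpolyK -combE comb0 trmx0; apply/colP => x; rewrite !mxE mcoeff0.
- have : ((coefvec n p)^T <= B)%MS.
    rewrite B_ker; apply/sub_kermxP; rewrite -trmx_mul.
    by rewrite -[_ *m _]/(colcomb n beta p) ker_p trmx0.
  by move=> /submxP[u def_u]; exists u; rewrite combE -def_u trmxK coefvecK.
Qed.

End RieszMoments.

(** * Splitting the Riesz functional along the line *)

Section Splitting.
Variable R : realType.
Local Notation P := (bipoly R).
Implicit Types (p q s : P) (c d z : R * R).

Variable beta : nat -> nat -> R.
Hypotheses (hcons : consistent 3 beta) (hpsd : psdmx (momentmx 3 beta))
  (hpd : pdmx (momentmx 2 beta)).
Variables (a b : R * R) (G : 'I_3 -> P).
Hypotheses (ne_ab : a != b) (G_3 : forall i, (bisize (G i) <= 3)%N)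
  (G_indep : forall u, (bisize (comb G u) <= 2)%N -> u = 0)
  (varietyE : forall z, variety 3 beta z <->
     peval (line a b) z = 0 \/ forall i, peval (G i) z = 0).
Let l := line a b.
Let m := along a b.

Let l_2 : (bisize l <= 2)%N. Proof. exact: bisize_line. Qed.

(** If q vanished on V, so would q^2, and consistency would give
    [riesz beta (q ^+ 2) = 0], against M(2) > 0. *)
Lemma not_on_conic q : (bisize q <= 3)%N -> q != 0 ->
  exists2 z, variety 3 beta z & peval q z != 0.
Proof.
move=> q_3 q_neq0.
have [//|no_z] := pselect (exists2 z, variety 3 beta z & peval q z != 0).
have := riesz_sqr_gt0 hpd q_3 q_neq0; rewrite hcons ?ltxx // => [|z z_V].
  by rewrite /deg_le expr2 (leq_trans (bisizeM (d := 2) q_3 q_3)).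
rewrite pevalXn; suff -> : peval q z = 0 by rewrite expr0n.
by apply/eqP; case: (boolP (peval q z == 0)) => // q_z; case: no_z; exists z.
Qed.

(** Apply [not_on_conic] to the product of q and the line. *)
Lemma exists_off_line q : (bisize q <= 2)%N -> q != 0 ->
  exists z, [/\ variety 3 beta z, peval l z != 0 & peval q z != 0].
Proof.
move=> q_2 q_neq0; have [||z z_V lq_z] := @not_on_conic (l * q).
- exact: leq_trans (bisizeM l_2 q_2) _.
- rewrite mulf_neq0 //; have [z] := line_nonvanishing ne_ab.
  by apply: contraNneq => l0; rewrite -/l l0 peval0.
by move: lq_z; rewrite pevalM mulf_eq0 negb_or => /andP[z_l z_q]; exists z.
Qed.

(** Each new point is chosen off the line l and off an affine function that
    vanishes at the points already found. *)
Lemma exists_triangle : exists w : 'I_3 -> R * R,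
  [/\ forall i, variety 3 beta (w i), forall i, peval l (w i) != 0 &
    peval (line (w (inord 0)) (w (inord 1))) (w (inord 2)) != 0].
Proof.
have line_neq0 c d : c != d -> line c d != 0.
  by move/line_nonvanishing => [z]; apply: contraNneq => ->; rewrite peval0.
have [||w0 [w0_V w0_l _]] := @exists_off_line 1; rewrite ?oner_neq0 ?mmeasure1 //.
(* An auxiliary second point, to obtain an affine function vanishing at w0. *)
have ne0 : w0 != (w0.1 + 1, w0.2).
  apply/negP => /eqP/(congr1 fst) /= /eqP.
  by rewrite eq_sym -subr_eq0 addrAC subrr add0r oner_eq0.
have [w1 [w1_V w1_l w01]] := exists_off_line (bisize_line w0 _) (line_neq0 _ _ ne0).
have ne1 : w0 != w1 by apply: contraNneq w01 => <-; rewrite peval_line_a.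
have [w2 [w2_V w2_l w012]] := exists_off_line (bisize_line _ _) (line_neq0 _ _ ne1).
exists (fun i : 'I_3 => nth w0 [:: w0; w1; w2] i); rewrite !inordK //=; split=> //.
  by case=> [[|[|[|]]]].
by case=> [[|[|[|]]]].
Qed.

(** Among the four polynomials q, G 0, G 1, G 2 of degree at most 2 some
    nontrivial combination loses its three leading coefficients.  It is then
    affine and vanishes at the vertices of a triangle, so it is 0; by
    independence of G it involves q. *)
Lemma conic_vanishes q z : (bisize q <= 3)%N ->
  forall w : 'I_3 -> R * R,
  peval (line (w (inord 0)) (w (inord 1))) (w (inord 2)) != 0 ->
  (forall i, peval q (w i) = 0) -> (forall i j, peval (G j) (w i) = 0) ->
  (forall i, peval (G i) z = 0) -> peval q z = 0.
Proof.
move=> q_3 w w_nc q_w G_w G_z.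
pose Q (i : 'I_(3 + 1)) := match fintype.split i with inl j => G j | inr _ => q end.
have QE u : comb Q u = comb G (lsubmx u) + rsubmx u ord0 ord0 *: q.
  rewrite /comb big_split_ord big_ord1 /Q; congr (_ + _).
    apply: eq_bigr => i _; case: splitP => j eq_ij; last first.
      by move: eq_ij (ltn_ord i) => /=; lia.
    by rewrite !mxE (_ : j = i) //; apply: val_inj.
  case: splitP => j eq_ij; first by have := ltn_ord j; rewrite -eq_ij.
  by rewrite [in RHS]mxE.
have [u u_neq0 uA] := @kernel_row _ (3 + 1) 3 (\matrix_(i, k)
  mcoeff (Multinom [tuple (2 - k)%N; k : nat]) (Q i)) (isT : 3 < 4)%N.
have Q_3 i : (bisize (Q i) <= 3)%N by rewrite /Q; case: fintype.split.
have uQ_2 : (bisize (comb Q u) <= 2)%N.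
  apply: bisize_drop_top; first exact: bisize_comb.
  move=> k; have /rowP/(_ k) := uA; rewrite !mxE raddf_sum /= => uA0.
  by rewrite -[RHS]uA0; apply: eq_bigr => i _; rewrite mcoeffZ mxE.
have uQ_w i : peval (comb Q u) (w i) = 0.
  by apply: comb_peval0 => j; rewrite /Q; case: fintype.split.
have uQ0 : comb Q u = 0 by apply: (affine_eq0 uQ_2 w_nc).
have c_neq0 : rsubmx u ord0 ord0 != 0.
  apply: contra_neq u_neq0 => c0; have lu0 : lsubmx u = 0.
    by apply: G_indep; move: uQ0; rewrite QE c0 scale0r addr0 => ->; rewrite mmeasure0.
  rewrite -[u]hsubmxK lu0; apply/rowP => i; rewrite !mxE.
  case: splitP => j _; first by rewrite mxE.
  by rewrite [j]ord1 c0.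
have := congr1 (fun p => peval p z) uQ0.
rewrite /= QE pevalD pevalZ comb_peval0 // add0r peval0 => /eqP.
by rewrite mulf_eq0 (negbTE c_neq0) => /eqP.
Qed.

Section Triangle.
Variable w : 'I_3 -> R * R.
Hypotheses (w_V : forall i, variety 3 beta (w i)) (w_l : forall i, peval l (w i) != 0)
  (w_nc : peval (line (w (inord 0)) (w (inord 1))) (w (inord 2)) != 0).

Lemma net_off_line z : variety 3 beta z -> peval l z != 0 ->
  forall i, peval (G i) z = 0.
Proof. by move=> /varietyE[-> /eqP//|]. Qed.

(** Each pair of sides of the triangle is a conic through its vertices, so it
    passes through z by [conic_vanishes]. *)
Lemma off_line_triangle z : variety 3 beta z -> peval l z != 0 -> exists i, z = w i.
Proof.
move=> z_V z_l.
have G_w i j : peval (G j) (w i) = 0 by apply: net_off_line.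
have G_z i : peval (G i) z = 0 by apply: net_off_line.
move: w_nc; set w0 := w (inord 0); set w1 := w (inord 1); set w2 := w (inord 2) => nc.
have pair_eq0 c1 c2 d1 d2 :
    (forall i, peval (line c1 c2) (w i) * peval (line d1 d2) (w i) = 0) ->
    peval (line c1 c2) z = 0 \/ peval (line d1 d2) z = 0.
  move=> cd_w; suff /eqP : peval (line c1 c2 * line d1 d2) z = 0.
    by rewrite pevalM mulf_eq0 => /orP[]/eqP->; [left|right].
  apply: (conic_vanishes _ w_nc) => // [|i]; last by rewrite pevalM.
  by rewrite (leq_trans (bisizeM (d := 1) (bisize_line _ _) (bisize_line _ _))).
have [] := pair_eq0 w0 w1 w0 w2.
- by move=> i; case: (ord3P i) => ->; rewrite -/w0 -/w1 -/w2
    ?peval_line_a ?peval_line_b ?mulr0 ?mul0r.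
- move=> l01; have [] := pair_eq0 w0 w2 w1 w2.
  + by move=> i; case: (ord3P i) => ->; rewrite -/w0 -/w1 -/w2
    ?peval_line_a ?peval_line_b ?mulr0 ?mul0r.
  + by move=> l02; exists (inord 0); apply: line_meet nc l01 l02.
  + move=> l12; exists (inord 1); apply: (@line_meet _ w1 w2 w0 z) => //.
      by rewrite -line_rot.
    by rewrite line_swap l01 oppr0.
- move=> l02; have [] := pair_eq0 w0 w1 w1 w2.
  + by move=> i; case: (ord3P i) => ->; rewrite -/w0 -/w1 -/w2
    ?peval_line_a ?peval_line_b ?mulr0 ?mul0r.
  + by move=> l01; exists (inord 0); apply: line_meet nc l01 l02.
  + move=> l12; exists (inord 2); apply: (@line_meet _ w2 w0 w1 z).
    * by rewrite line_rot.
    * by rewrite line_swap l02 oppr0.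
    * by rewrite line_swap l12 oppr0.
Qed.

Variable e : 'I_3 -> P.
Hypotheses (e_2 : forall i, (bisize (e i) <= 2)%N)
  (eE : forall i j, peval (e i) (w j) = (i == j)%:R).

Lemma interpolation (c : 'I_3 -> R) j : peval (\sum_i c i *: e i) (w j) = c j.
Proof.
rewrite peval_sum (bigD1 j) //= big1 => [|i ne_ij].
  by rewrite pevalZ eE eqxx mulr1 addr0.
by rewrite pevalZ eE (negbTE ne_ij) mulr0.
Qed.

(** The weight of w i in the measure, since l e_i vanishes on V except at w i. *)
Definition mass i : R := riesz beta (l * e i) / peval l (w i).

(** Let s' be the affine function that interpolates s at the points w i.  Then
    l (s - s') vanishes on V, so consistency replaces s by s'. *)
Lemma riesz_mul_line s : (bisize s <= 6)%N ->
  riesz beta (l * s) = \sum_i mass i * peval (l * s) (w i).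
Proof.
move=> s_6; pose s' : P := \sum_i peval s (w i) *: e i.
have s'_w i : peval s' (w i) = peval s (w i) by apply: interpolation.
have s'_6 : (bisize s' <= 6)%N.
  by apply: bisize_sum => i _; rewrite bisizeZ // (leq_trans (e_2 i)).
have : riesz beta (l * (s - s')) = 0.
  apply: hcons => [|z z_V].
    by rewrite /deg_le (leq_trans (bisizeM (d := 1) (e := 6) l_2 _)) // bisizeB.
  rewrite pevalM; have [-> |z_l] := eqVneq (peval l z) 0; first by rewrite mul0r.
  have [i ->] := off_line_triangle z_V z_l.
  by rewrite pevalB s'_w subrr mulr0.
rewrite mulrBr rieszB => /subr0_eq ->; rewrite mulr_sumr riesz_sum.
apply: eq_bigr => i _; rewrite -scalerAr rieszZ pevalM /mass.
by rewrite mulrA mulfVK // mulrC.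
Qed.

(** The square of l e_i is a multiple of l that vanishes at the other w j, and
    l e_i has degree at most 2. *)
Lemma mass_gt0 i : 0 < mass i.
Proof.
have le_neq0 : l * e i != 0.
  have : peval (l * e i) (w i) != 0 by rewrite pevalM eE eqxx mulr1.
  by apply: contraNneq => ->; rewrite peval0.
have le_3 : (bisize (l * e i) <= 3)%N by rewrite (leq_trans (bisizeM l_2 (e_2 i))).
have := riesz_sqr_gt0 hpd le_3 le_neq0.
have -> : (l * e i) ^+ 2 = l * (l * e i * e i) by ring.
rewrite riesz_mul_line; last by rewrite (leq_trans (bisizeM (d := 2) le_3 (e_2 i))).
rewrite (bigD1 i) //= big1 => [|j ne_ji].
  have l_gt0 : 0 < peval l (w i) ^+ 2 by rewrite exprn_even_gt0 //= w_l.
  by rewrite !pevalM eE eqxx !mulr1 addr0 -expr2 pmulr_lgt0.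
by rewrite !pevalM eE eq_sym (negbTE ne_ji) !mulr0.
Qed.

(** What remains of the Riesz functional, on polynomials in the coordinate of the
    line, once the masses at the points w i are removed. *)
Definition residual (r : {poly R}) : R :=
  riesz beta (horner_alg m r) - \sum_i mass i * r.[peval m (w i)].

Lemma residual_is_scalar : scalar residual.
Proof.
move=> c r s; rewrite /residual rmorphD /= horner_algZ rieszD rieszZ.
have -> : \sum_i mass i * (c *: r + s).[peval m (w i)] =
    c * (\sum_i mass i * r.[peval m (w i)]) + \sum_i mass i * s.[peval m (w i)].
  rewrite mulr_sumr -big_split; apply: eq_bigr => i _ /=.
  by rewrite hornerD hornerZ; ring.
by ring.
Qed.

Lemma sqr_vanish q : (bisize q <= 4)%N -> riesz beta (q ^+ 2) = 0 ->
  forall z, variety 3 beta z -> peval q z = 0.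
Proof.
move=> q_4; rewrite expr2 (riesz_moment beta q_4 q_4) => /psd_kernel q0 z z_V.
apply: z_V; split=> //; exact: q0 hpsd.1 hpsd.2.
Qed.

(** The polynomial h on the line extends to the cubic q = h + l g, with g affine
    chosen so that q vanishes at the points w i.  Hence the residual functional
    at h^2 is [riesz beta (q ^+ 2)].  If this is 0, then q lies in the kernel of
    M(3), so it vanishes on V and in particular on the line, where it is h. *)
Lemma residual_gt0 (h : {poly R}) : h != 0 -> (size h <= 4)%N -> 0 < residual (h ^+ 2).
Proof.
move=> h_neq0 h_4.
pose g : P := \sum_i (- (h.[peval m (w i)] / peval l (w i))) *: e i.
pose H : P := horner_alg m h.
have g_2 : (bisize g <= 2)%N by apply: bisize_sum => i _; apply: bisizeZ.
have H_4 : (bisize H <= 4)%N by apply: bisize_horner => //; apply: bisize_along.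
pose q := H + l * g.
have q_4 : (bisize q <= 4)%N by rewrite bisizeD // (leq_trans (bisizeM l_2 g_2)).
have q_w i : peval q (w i) = 0.
  by rewrite pevalD pevalM peval_horner interpolation mulrN mulrC divfK ?subrr.
pose s := H * g + H * g + l * (g * g).
have s_6 : (bisize s <= 6)%N.
  have Hg_6 : (bisize (H * g) <= 6)%N by rewrite (leq_trans (bisizeM (d := 3) H_4 g_2)).
  have gg_3 : (bisize (g * g) <= 3)%N by rewrite (leq_trans (bisizeM (d := 1) g_2 g_2)).
  by rewrite !bisizeD // (leq_trans (bisizeM (d := 1) l_2 gg_3)).
have q_sq : q ^+ 2 = horner_alg m (h ^+ 2) + l * s.
  by rewrite rmorphXn /= -/H /q /s; ring.
have res_sq : residual (h ^+ 2) = riesz beta (q ^+ 2).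
  rewrite /residual q_sq rieszD riesz_mul_line // -sumrN; congr (_ + _).
  apply: eq_bigr => i _; rewrite -mulrN; congr (_ * _).
  have := congr1 (fun p => peval p (w i)) q_sq.
  rewrite /= pevalXn q_w expr0n pevalD peval_horner => /eqP.
  by rewrite eq_sym addrC addr_eq0 => /eqP.
rewrite res_sq lt_def (riesz_sqr_ge0 hpsd q_4) andbT.
apply: contra_neq h_neq0 => /(sqr_vanish q_4) q_V.
have [//|/exists_nonroot[t]] := eqVneq h 0.
have := q_V (line_pt a b t); rewrite pevalD pevalM peval_line_pt mul0r addr0.
rewrite peval_horner peval_along_pt // => -> //; first by rewrite eqxx.
by apply/varietyE; left; rewrite peval_line_pt.
Qed.

Lemma triangle_measure : exists (z : 'I_7 -> R * R) (rho : 'I_7 -> R),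
  [/\ injective z, forall i, 0 < rho i & forall p, (bisize p <= 7)%N ->
    riesz beta p = \sum_i rho i * peval p (z i)].
Proof.
pose L : {scalar {poly R}} := HB.pack residual
  (GRing.isLinear.Build R {poly R} R *%R residual residual_is_scalar).
have [t [om [uniq_t om_gt0 L_sum]]] := @gauss_quadrature R 4 L residual_gt0.
pose z (i : 'I_(3 + 4)) :=
  match fintype.split i with inl j => w j | inr j => line_pt a b (tnth t j) end.
pose rho (i : 'I_(3 + 4)) :=
  match fintype.split i with inl j => mass j | inr j => om j end.
have w_inj : injective w.
  move=> k k' eq_w; have := eE k k; rewrite {1}eq_w eE.
  by case: (k =P k') => // _; rewrite eqxx => /esym/eqP; rewrite oner_eq0.
have w_pt k y : w k <> line_pt a b y.
  by move=> eq_w; case/eqP: (w_l k); rewrite eq_w; exact: peval_line_pt.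
have z_inj : injective z.
  move=> i j; rewrite /z => eq_z; rewrite -(splitK i) -(splitK j); move: eq_z.
  case: (fintype.split i) => k; case: (fintype.split j) => k' /=.
  - by move=> /w_inj ->.
  - by move=> /w_pt.
  - by move=> /esym/w_pt.
  - move=> /(congr1 (fun z => peval (along a b) z)); rewrite !peval_along_pt // => eq_t.
    by congr (rshift _ _); have /tuple_uniqP := uniq_t; apply.
have rho_gt0 i : 0 < rho i.
  by rewrite /rho; case: (fintype.split i) => k; [apply: mass_gt0|apply: om_gt0].
exists z, rho; split=> // p p_7.
have [g [r [g_6 r_7 def_p]]] := line_division ne_ab p_7.
have -> : riesz beta p = \sum_i mass i * peval p (w i) + L r.
  rewrite [in LHS]def_p rieszD riesz_mul_line // -/m /L /= /residual.
  rewrite [RHS]addrCA addrC; congr (_ + _); rewrite -sumrB; apply: eq_bigr => i _.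
  by rewrite [in RHS]def_p pevalD peval_horner mulrDr addrK.
rewrite (@big_split_ord _ _ _ 3 4) /rho /z; congr (_ + _).
  by apply: eq_bigr => i _; rewrite (unsplitK (inl i)).
rewrite L_sum ?(leq_trans r_7) //; apply: eq_bigr => i _; rewrite (unsplitK (inr i)).
by rewrite def_p pevalD pevalM peval_line_pt mul0r add0r peval_horner peval_along_pt.
Qed.

End Triangle.

Lemma split_measure : exists (z : 'I_7 -> R * R) (rho : 'I_7 -> R),
  [/\ injective z, forall i, 0 < rho i & forall p, (bisize p <= 7)%N ->
    riesz beta p = \sum_i rho i * peval p (z i)].
Proof.
have [w [w_V w_l w_nc]] := exists_triangle.
have [e [e_2 eE]] := lagrange3 w_nc.
exact: (triangle_measure w_V w_l w_nc e_2 eE).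
Qed.

End Splitting.

(** * Finitely atomic measures *)

Section Atoms.
Context d (T : measurableType d) (R : realType) (n : nat).
Variables (z : 'I_n.+1 -> T) (rho : 'I_n.+1 -> {nonneg R}).

(** [msum] sums a sequence of measures, whence the detour through [inord]. *)
Definition atomic_measure : {measure set T -> \bar R} :=
  msum (fun k => mscale (rho (inord k)) (dirac (z (inord k)))) n.+1.

Lemma atomic_measureE A :
  atomic_measure A = (\sum_i (rho i)%:num%:E * \d_(z i) A)%E.
Proof. by apply: eq_bigr => i _; rewrite /= /mscale inord_val. Qed.

Lemma ge0_integral_atomic (f : T -> \bar R) : measurable_fun setT f ->
  (forall x, 0 <= f x)%E ->
  (\int[atomic_measure]_x f x = \sum_i (rho i)%:num%:E * f (z i))%E.
Proof.
move=> mf f_ge0; rewrite ge0_integral_measure_sum //; apply: eq_bigr => i _.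
rewrite ge0_integral_mscale // integral_dirac // inord_val.
by rewrite diracT mul1e.
Qed.

Lemma integrable_atomic (f : T -> R) : measurable_fun setT f ->
  atomic_measure.-integrable setT (EFin \o f).
Proof.
move=> mf; apply/integrableP; split; first exact/measurable_EFinP.
rewrite ge0_integral_atomic //=; last first.
  by apply/measurable_EFinP; apply: measurableT_comp.
by rewrite sumEFin ltry.
Qed.

(** Apply the formula for nonnegative functions to the positive and negative
    parts of f. *)
Lemma integral_atomic (f : T -> R) : measurable_fun setT f ->
  (\int[atomic_measure]_x (f x)%:E = (\sum_i (rho i)%:num * f (z i))%:E)%E.
Proof.
move=> mf; have mEf : measurable_fun setT (EFin \o f) by exact/measurable_EFinP.
rewrite integralE ge0_integral_atomic //; last exact: measurable_funepos.
rewrite ge0_integral_atomic //; last exact: measurable_funeneg.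
have posE x : ((EFin \o f)^\+ x = (Num.max (f x) 0)%:E)%E.
  by rewrite funeposE EFin_max.
have negE x : ((EFin \o f)^\- x = (Num.max (- f x) 0)%:E)%E.
  by rewrite funenegE EFin_max.
under eq_bigr do rewrite posE -EFinM.
under [X in (_ - X)%E]eq_bigr do rewrite negE -EFinM.
rewrite !sumEFin -EFinB -sumrB; congr _%:E; apply: eq_bigr => i _.
rewrite -mulrBr; congr (_ * _); rewrite /Num.max oppr_lt0.
case: (ltgtP (f (z i)) 0) => [f_lt0|f_gt0|->]; rewrite ?oppr0 ?addr0 ?sub0r ?opprK //.
Qed.

End Atoms.

Section AtomicMeasures.
Variable R : realType.
Local Notation P := (bipoly R).

Lemma atomic_of_riesz n beta (z : 'I_n.+1 -> R * R) (rho : 'I_n.+1 -> R) k :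
  injective z -> (forall i, 0 < rho i) ->
  (forall p : P, (bisize p <= (2 * k).+1)%N ->
    riesz beta p = \sum_i rho i * peval p (z i)) ->
  exists mu : {measure set (R * R) -> \bar R}, atomic n.+1 mu /\ representing k beta mu.
Proof.
move=> z_inj rho_gt0 rieszE.
exists (atomic_measure z (fun i => NngNum (ltW (rho_gt0 i)))); split.
  by exists z, rho; split=> // A _; rewrite atomic_measureE.
move=> i j le_ij f.
have mf : measurable_fun setT (fun x : R * R => x.1 ^+ i * x.2 ^+ j).
  apply: measurable_funM; apply: measurable_funX.
    exact: measurable_fst.
  exact: measurable_snd.
split; first exact: integrable_atomic.
rewrite integral_atomic //; congr _%:E.
pose m := Multinom [tuple i; j].
have m0 : m ord0 = i by rewrite multinomE (tnth_nth 0%N).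
have m1 : m ord_max = j by rewrite multinomE (tnth_nth 0%N).
rewrite -[in RHS]m0 -[in RHS]m1 -rieszX rieszE; last first.
  by rewrite mmeasureX /= mdeg2 m0 m1.
apply: eq_bigr => x _; congr (_ * _).
rewrite /peval mevalX big_ord_recl big_ord1.
rewrite (_ : lift _ _ = ord_max); last exact: val_inj.
by rewrite m0 m1 !(tnth_nth 0).
Qed.

Lemma uniq_seq_of_card_le (n : nat) (V : set (R * R)) : `I_n #<= V ->
  exists s : seq (R * R), [/\ uniq s, size s = n & forall x, x \in s -> V x].
Proof.
move=> /pcard_leP[f]; exists [seq f i | i <- iota 0 n]; split.
- rewrite map_inj_in_uniq ?iota_uniq // => x y; rewrite !mem_iota /= => x_n y_n.
  by move=> eq_f; apply: (inj _ _ eq_f); rewrite inE.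
- by rewrite size_map size_iota.
- by move=> x /mapP[i]; rewrite mem_iota /= => i_n ->; apply: funS.
Qed.

End AtomicMeasures.

(** * The seven-atomic measure *)

Theorem theorem1p3 (R : realType) (beta : nat -> nat -> R)
    (hcons : consistent 3 beta)
    (hpsd : psdmx (momentmx 3 beta))
    (hpd : pdmx (momentmx 2 beta))
    (hrank : \rank (momentmx 3 beta) = 7%N)
    (hv : `I_8 #<= variety 3 beta) :
  exists mu : {measure set (R * R) -> \bar R},
    atomic 7 mu /\ representing 3 beta mu.
Proof.
have [|F [F_4 F_ker F_inj F_span]] := @kernel_basis R 3 beta 3; first by rewrite hrank.
(* An element of the kernel of M(3) of degree at most 2 is isotropic for M(2). *)
have F_indep u : (bisize (comb F u) <= 3)%N -> u = 0.
  move=> F_3; apply: F_inj.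
  have ker_u : colcomb 3 beta (comb F u) = 0.
    exact: colcomb_comb.
  case: (eqVneq (comb F u) 0) => // F_neq0.
  have := riesz_sqr_gt0 hpd F_3 F_neq0.
  have Fu_4 : (bisize (comb F u) <= 4)%N by apply: bisize_comb.
  rewrite expr2 (riesz_moment beta Fu_4 Fu_4) -mulmxA.
  by rewrite -[_ *m coefvec _ _]/(colcomb 3 beta _) ker_u mulmx0 mxE ltxx.
have varietyE z : variety 3 beta z <-> forall i, peval (F i) z = 0.
  split=> [z_V i|F_z p [p_3 p_ker]].
    by apply: z_V; split; [exact: F_4|exact: F_ker].
  by have [u ->] := F_span p p_3 p_ker; exact: (comb_peval0 u F_z).
have [s [uniq_s size_s s_V]] := uniq_seq_of_card_le hv.
have zero_s : base_points F s.
  rewrite /base_points uniq_s; apply/allP => x /s_V/varietyE F_x.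
  by apply/forallP => i; rewrite F_x.
have [a [b [ne_ab F_div]]] := net_common_line F_4 F_indep zero_s size_s.
have [G [G_3 FE]] : exists G : 'I_3 -> bipoly R,
    (forall i, (bisize (G i) <= 3)%N) /\ forall i, F i = line a b * G i.
  have F_ex i : exists g, (bisize g <= 3)%N /\ F i = line a b * g.
    by have [g] := F_div i; exists g.
  by have [G GE] := choice F_ex; exists G; split=> i; have [] := GE i.
have [z [rho [z_inj rho_gt0 rieszE]]] : exists (z : 'I_7 -> R * R) (rho : 'I_7 -> R),
    [/\ injective z, forall i, 0 < rho i & forall p, (bisize p <= 7)%N ->
    riesz beta p = \sum_i rho i * peval p (z i)].
  apply: (@split_measure _ beta hcons hpsd hpd a b G) => // [u G_2|z].
    apply: F_indep; rewrite (_ : comb F u = line a b * comb G u).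
      exact: leq_trans (bisizeM (bisize_line a b) G_2) _.
    by rewrite /comb mulr_sumr; apply: eq_bigr => i _; rewrite FE -scalerAr.
  rewrite varietyE; split=> [F_z|[l_z|G_z] i]; last 2 first.
  - by rewrite FE pevalM l_z mul0r.
  - by rewrite FE pevalM G_z mulr0.
  have [|l_z] := eqVneq (peval (line a b) z) 0; [by left|right => i].
  by apply: off_line l_z; rewrite -FE.
exact: (@atomic_of_riesz R 6 beta z rho 3 z_inj rho_gt0 rieszE).
Qed.
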